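(* Let $F:M\times[0,T)\to(N,g)$ be a smooth solution of the mean curvature flow. Then the second fundamental tensor $A=A^\alpha_{ij}\frac{\partial}{\partial y^\alpha}\otimes dx^i\otimes dx^j$ evolves by $$\nabla_{\frac{d}{dt}}A^\alpha_{ij}=\nabla_i\nabla_jH^\alpha-C^k_{ij}F^\alpha_k+R^\alpha{}_{\delta\gamma\epsilon}F^\delta_jH^\gamma F^\epsilon_i,$$ where $C^k_{ij}=\frac{d}{dt}\Gamma^k_{ij}$.
   Context: $M$ is a smooth oriented closed manifold of dimension $m$, $(N,g)$ is a smooth Riemannian manifold of dimension $n$. A smooth solution of the mean curvature flow is a smooth map $F:M\times[0,T)\to N$ such that each $F_t=F(\cdot,t)$ is an immersion and $\frac{dF}{dt}(p,t)=\overrightarrow H(p,t)$, where $\overrightarrow H(\cdot,t)$ is the mean curvature vector of $F_t$. Local coordinates are $(x^i)_{i=1,\dots,m}$ on $M$ and $(y^\alpha)_{\alpha=1,\dots,n}$ on $N$; repeated indices are summed. $F^\alpha_i=\partial F^\alpha/\partial x^i$, $g_{ij}=g_{\alpha\beta}F^\alpha_iF^\beta_j$ is the induced metric with inverse $(g^{ij})$; $\Gamma^k_{ij}$ and $\Gamma^\alpha_{\beta\gamma}$ are the Christoffel symbols of $(M,F_t^*g)$ and $(N,g)$. The second fundamental tensor $A=\nabla DF$ has components $$A^\alpha_{ij}=\frac{\partial^2F^\alpha}{\partial x^i\partial x^j}-\Gamma^k_{ij}F^\alpha_k+\Gamma^\alpha_{\beta\gamma}F^\beta_iF^\gamma_j,$$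 and $\overrightarrow H=H^\alpha\frac{\partial}{\partial y^\alpha}$ with $H^\alpha=g^{ij}A^\alpha_{ij}$. $\nabla$ denotes the full connection on bundles built from $F^*TN$, $TM$, $T^*M$ (the pull-back of the Levi-Civita connection of $N$ on $F^*TN$ and the Levi-Civita connection of $F_t^*g$ on $TM$, $T^*M$), not the normal connection. For a section $V=V^\alpha\frac{\partial}{\partial y^\alpha}$ of $F^*TN$, $\nabla_jV^\alpha=\frac{\partial V^\alpha}{\partial x^j}+\Gamma^\alpha_{\beta\gamma}F^\beta_jV^\gamma$ and $$\nabla_i\nabla_jV^\alpha=\frac{\partial}{\partial x^i}(\nabla_jV^\alpha)-\Gamma^k_{ij}\nabla_kV^\alpha+\Gamma^\alpha_{\beta\gamma}F^\beta_i\nabla_jV^\gamma .$$ The time derivative is the covariant derivative along $\frac{d}{dt}$ in the pull-back of $TN$ by $F:M\times[0,T)\to N$: $$\nabla_{\frac{d}{dt}}A^\alpha_{ij}=\frac{d}{dt}A^\alpha_{ij}+\Gamma^\alpha_{\beta\gamma}H^\beta A^\gamma_{ij}.$$ Curvature convention: $R^N(X,Y)Z=\nabla_X\nabla_YZ-\nabla_Y\nabla_XZ-\nabla_{[X,Y]}Z$, $R_{\alpha\beta\gamma\delta}=\langle\frac{\partial}{\partial y^\alpha},R^N(\frac{\partial}{\partial y^\gamma},\frac{\partial}{\partial y^\delta})\frac{\partial}{\partial y^\beta}\rangle$ and $R^\alpha{}_{\beta\gamma\delta}=g^{\alpha\epsilon}R_{\epsilon\beta\gamma\delta}$. *)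

(* Defs.v *)
From HB Require Import structures.
From mathcomp Require Import all_boot all_order all_algebra.
From mathcomp Require Import all_classical all_reals all_analysis.

Set Implicit Arguments.
Unset Strict Implicit.
Unset Printing Implicit Defensive.

Import Order.TTheory GRing.Theory Num.Theory.
Import numFieldNormedType.Exports.

Local Open Scope classical_set_scope.
Local Open Scope ring_scope.

(** * Calculus *)

Definition pd (R : realType) (m : nat) (i : 'I_m) (f : 'rV[R]_m -> R)
  (x : 'rV[R]_m) : R := 'D_(delta_mx 0 i) f x.

Definition iterD (R : realType) (V W : normedModType R) (vs : seq V)
  (f : V -> W) : V -> W := foldr (fun v h => 'D_v h) f vs.

(* For U open and V finite-dimensional, this is C^oo on U: all iterated
   directional derivatives exist and are continuous at the points of U. *)
Definition smooth_on (R : realType) (V W : normedModType R) (U : set V)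
    (f : V -> W) : Prop :=
  forall (vs : seq V) (x : V), U x ->
    {for x, continuous (iterD vs f)} /\
    (forall v : V, derivable (iterD vs f) x v).

(* The time interval [0, T), where T may be +oo. *)
Definition time_dom (R : realType) (T : \bar R) : set R :=
  [set t | 0 <= t /\ (t%:E < T)%E].

(* d/dt on [0, T): the limit of difference quotients with s in [0, T), hence
   the usual derivative for t > 0 and the right derivative at t = 0. *)
Definition ddt (R : realType) (T : \bar R) (f : R -> R) (t : R) : R :=
  lim ((s - t)^-1 * (f s - f t) @[s --> within (time_dom T) t^']).

(** * Smooth manifolds *)

(* Only the values of [chart_fun] on [chart_dom] and those of [chart_inv] on
   [chart_cod] are meaningful. *)
Record chart (R : realType) (M : topologicalType) (m : nat) := Chart {
  chart_dom : set M;
  chart_cod : set 'rV[R]_m;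
  chart_fun : M -> 'rV[R]_m;
  chart_inv : 'rV[R]_m -> M;
  chart_dom_open : open chart_dom;
  chart_cod_open : open chart_cod;
  chart_funP : forall p, chart_dom p -> chart_cod (chart_fun p);
  chart_invP : forall x, chart_cod x -> chart_dom (chart_inv x);
  chart_funK : forall p, chart_dom p -> chart_inv (chart_fun p) = p;
  chart_invK : forall x, chart_cod x -> chart_fun (chart_inv x) = x;
  chart_fun_cts : forall p, chart_dom p -> {for p, continuous chart_fun};
  chart_inv_cts : forall x, chart_cod x -> {for x, continuous chart_inv} }.

Definition transition (R : realType) (M : topologicalType) (m : nat)
  (c c' : chart R M m) : 'rV[R]_m -> 'rV[R]_m :=
  chart_fun c' \o chart_inv c.

Definition transition_dom (R : realType) (M : topologicalType) (m : nat)
  (c c' : chart R M m) : set 'rV[R]_m :=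
  chart_cod c `&` (chart_inv c @^-1` chart_dom c').

(* Entry (i, j) is the derivative of the j-th new coordinate with respect to
   the i-th old one. *)
Definition transition_jac (R : realType) (M : topologicalType) (m : nat)
  (c c' : chart R M m) (x : 'rV[R]_m) : 'M[R]_m :=
  \matrix_(i, j) pd i (fun z => transition c c' z 0 j) x.

Record smooth_structure (R : realType) (M : topologicalType) (m : nat) :=
  SmoothStructure {
  atlas : set (chart R M m);
  manifold_hausdorff : hausdorff_space M;
  manifold_countable : @second_countable M;
  atlas_cover : forall p : M, exists2 c, atlas c & chart_dom c p;
  atlas_smooth : forall c c', atlas c -> atlas c' ->
    smooth_on (transition_dom c c') (transition c c');
  atlas_maximal : forall c,
    (forall c', atlas c' ->
       smooth_on (transition_dom c c') (transition c c') /\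
       smooth_on (transition_dom c' c) (transition c' c)) ->
    atlas c }.

Record orientation (R : realType) (M : topologicalType) (m : nat)
    (SM : smooth_structure R M m) := Orientation {
  oriented_atlas : set (chart R M m);
  oriented_sub : oriented_atlas `<=` atlas SM;
  oriented_cover : forall p : M,
    exists2 c, oriented_atlas c & chart_dom c p;
  oriented_pos : forall c c' x, oriented_atlas c -> oriented_atlas c' ->
    transition_dom c c' x -> 0 < \det (transition_jac c c' x) }.

(* A Riemannian metric given by its matrices of components g_{ab} in the charts
   of the atlas, related by the transformation law of (0,2)-tensors. *)
Record riemannian_metric (R : realType) (N : topologicalType) (n : nat)
    (SN : smooth_structure R N n) := RiemannianMetric {
  metric_mx : chart R N n -> 'rV[R]_n -> 'M[R]_n;
  metric_smooth : forall c, atlas SN c ->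
    smooth_on (chart_cod c) (metric_mx c);
  metric_sym : forall c y, atlas SN c -> chart_cod c y ->
    (metric_mx c y)^T = metric_mx c y;
  metric_pos : forall c y (v : 'rV[R]_n), atlas SN c -> chart_cod c y ->
    v != 0 -> 0 < (v *m metric_mx c y *m v^T) 0 0;
  metric_change : forall c c' y, atlas SN c -> atlas SN c' ->
    transition_dom c c' y ->
    metric_mx c y =
      transition_jac c c' y *m metric_mx c' (transition c c' y)
        *m (transition_jac c c' y)^T }.

(* The map t, x |-> F^a(x, t) in the charts phi and psi. *)
Definition local_rep (R : realType) (M N : topologicalType) (m n : nat)
    (phi : chart R M m) (psi : chart R N n) (F : M -> R -> N)
    (t : R) (x : 'rV[R]_m) : 'rV[R]_n :=
  chart_fun psi (F (chart_inv phi x) t).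

(* Smoothness of F on the manifold with boundary M x [0, T): in charts, F has
   near each point (p, t) a smooth extension to an open set of R^m x R.  Values
   of F at times outside [0, T) are irrelevant. *)
Definition smooth_map (R : realType) (M N : topologicalType) (m n : nat)
    (SM : smooth_structure R M m) (SN : smooth_structure R N n)
    (T : \bar R) (F : M -> R -> N) : Prop :=
  forall phi psi p t, atlas SM phi -> atlas SN psi ->
    chart_dom phi p -> time_dom T t -> chart_dom psi (F p t) ->
    exists (W : set ('rV[R]_m * R)%type) (f : 'rV[R]_m * R -> 'rV[R]_n),
      [/\ open W, W (chart_fun phi p, t), smooth_on W f &
        forall x s, W (x, s) -> chart_cod phi x -> time_dom T s ->
          chart_dom psi (F (chart_inv phi x) s) /\
          f (x, s) = local_rep phi psi F s x].

(** * Riemannian geometry in local coordinates *)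

(* [christoffel g k i j] is Gamma^k_{ij}. *)
Definition christoffel (R : realType) (d : nat) (g : 'rV[R]_d -> 'M[R]_d)
    (k i j : 'I_d) (x : 'rV[R]_d) : R :=
  2^-1 * \sum_l invmx (g x) k l *
    (pd i (fun z => g z j l) x + pd j (fun z => g z i l) x
     - pd l (fun z => g z i j) x).

(* Vector fields are given by their rows of components; this is nabla_X Y. *)
Definition lc_connection (R : realType) (n : nat) (g : 'rV[R]_n -> 'M[R]_n)
    (X Y : 'rV[R]_n -> 'rV[R]_n) (y : 'rV[R]_n) : 'rV[R]_n :=
  \row_a \sum_b X y 0 b *
    (pd b (fun z => Y z 0 a) y + \sum_c christoffel g a b c y * Y y 0 c).

Definition lie_bracket (R : realType) (n : nat)
    (X Y : 'rV[R]_n -> 'rV[R]_n) (y : 'rV[R]_n) : 'rV[R]_n :=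
  \row_a \sum_b (X y 0 b * pd b (fun z => Y z 0 a) y
                 - Y y 0 b * pd b (fun z => X z 0 a) y).

Definition curvature (R : realType) (n : nat) (g : 'rV[R]_n -> 'M[R]_n)
    (X Y Z : 'rV[R]_n -> 'rV[R]_n) (y : 'rV[R]_n) : 'rV[R]_n :=
  lc_connection g X (lc_connection g Y Z) y
  - lc_connection g Y (lc_connection g X Z) y
  - lc_connection g (lie_bracket X Y) Z y.

Definition coord_field (R : realType) (n : nat) (a : 'I_n) :
  'rV[R]_n -> 'rV[R]_n := fun=> delta_mx 0 a.

(* R_{abcd} = < d_a , R(d_c, d_d) d_b > *)
Definition riemann_down (R : realType) (n : nat) (g : 'rV[R]_n -> 'M[R]_n)
    (a b c d : 'I_n) (y : 'rV[R]_n) : R :=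
  (coord_field a y *m g y *m
   (curvature g (coord_field c) (coord_field d) (coord_field b) y)^T) 0 0.

(* R^a_{bcd} *)
Definition riemann_up (R : realType) (n : nat) (g : 'rV[R]_n -> 'M[R]_n)
    (a b c d : 'I_n) (y : 'rV[R]_n) : R :=
  \sum_e invmx (g y) a e * riemann_down g e b c d y.

(** * Extrinsic geometry of t |-> F_t in local coordinates

    [g] is the metric of N in the coordinates y, [u t x] is F(x, t). *)

(* F^a_i; the matrix (F^a_i) has one row per i *)
Definition dF (R : realType) (m n : nat) (u : R -> 'rV[R]_m -> 'rV[R]_n)
    (t : R) (x : 'rV[R]_m) : 'M[R]_(m, n) :=
  \matrix_(i, a) pd i (fun z => u t z 0 a) x.

Definition induced_metric (R : realType) (m n : nat)
    (g : 'rV[R]_n -> 'M[R]_n) (u : R -> 'rV[R]_m -> 'rV[R]_n)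
    (t : R) (x : 'rV[R]_m) : 'M[R]_m :=
  \matrix_(i, j) \sum_a \sum_b g (u t x) a b * dF u t x i a * dF u t x j b.

Definition induced_christoffel (R : realType) (m n : nat)
    (g : 'rV[R]_n -> 'M[R]_n) (u : R -> 'rV[R]_m -> 'rV[R]_n)
    (k i j : 'I_m) (t : R) (x : 'rV[R]_m) : R :=
  christoffel (induced_metric g u t) k i j x.

(* A^a_{ij} *)
Definition second_form (R : realType) (m n : nat)
    (g : 'rV[R]_n -> 'M[R]_n) (u : R -> 'rV[R]_m -> 'rV[R]_n)
    (a : 'I_n) (i j : 'I_m) (t : R) (x : 'rV[R]_m) : R :=
  pd i (pd j (fun z => u t z 0 a)) x
  - \sum_k induced_christoffel g u k i j t x * dF u t x k a
  + \sum_b \sum_c christoffel g a b c (u t x) * dF u t x i b * dF u t x j c.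

(* H^a *)
Definition mean_curvature (R : realType) (m n : nat)
    (g : 'rV[R]_n -> 'M[R]_n) (u : R -> 'rV[R]_m -> 'rV[R]_n)
    (a : 'I_n) (t : R) (x : 'rV[R]_m) : R :=
  \sum_i \sum_j invmx (induced_metric g u t x) i j * second_form g u a i j t x.

(* nabla_j V^a, for a section V of F_t^* TN *)
Definition nabla1 (R : realType) (m n : nat)
    (g : 'rV[R]_n -> 'M[R]_n) (u : R -> 'rV[R]_m -> 'rV[R]_n) (t : R)
    (V : 'I_n -> 'rV[R]_m -> R) (j : 'I_m) (a : 'I_n) (x : 'rV[R]_m) : R :=
  pd j (V a) x
  + \sum_b \sum_c christoffel g a b c (u t x) * dF u t x j b * V c x.

(* nabla_i nabla_j V^a *)
Definition nabla2 (R : realType) (m n : nat)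
    (g : 'rV[R]_n -> 'M[R]_n) (u : R -> 'rV[R]_m -> 'rV[R]_n) (t : R)
    (V : 'I_n -> 'rV[R]_m -> R) (i j : 'I_m) (a : 'I_n) (x : 'rV[R]_m) : R :=
  pd i (nabla1 g u t V j a) x
  - \sum_k induced_christoffel g u k i j t x * nabla1 g u t V k a x
  + \sum_b \sum_c christoffel g a b c (u t x) * dF u t x i b
                  * nabla1 g u t V j c x.

(* nabla_{d/dt} A^a_{ij} *)
Definition nabla_dt_second_form (R : realType) (m n : nat) (T : \bar R)
    (g : 'rV[R]_n -> 'M[R]_n) (u : R -> 'rV[R]_m -> 'rV[R]_n)
    (a : 'I_n) (i j : 'I_m) (t : R) (x : 'rV[R]_m) : R :=
  ddt T (fun s => second_form g u a i j s x) t
  + \sum_b \sum_c christoffel g a b c (u t x) * mean_curvature g u b t x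
                  * second_form g u c i j t x.

(* C^k_{ij} *)
Definition ddt_christoffel (R : realType) (m n : nat) (T : \bar R)
    (g : 'rV[R]_n -> 'M[R]_n) (u : R -> 'rV[R]_m -> 'rV[R]_n)
    (k i j : 'I_m) (t : R) (x : 'rV[R]_m) : R :=
  ddt T (fun s => induced_christoffel g u k i j s x) t.

(** * Mean curvature flow *)

Record mean_curvature_flow (R : realType) (M N : topologicalType) (m n : nat)
    (SM : smooth_structure R M m) (SN : smooth_structure R N n)
    (g : riemannian_metric SN) (T : \bar R) (F : M -> R -> N) : Prop :=
  MeanCurvatureFlow {
  mcf_smooth : smooth_map SM SN T F;
  mcf_immersion : forall phi psi p t, atlas SM phi -> atlas SN psi ->
    chart_dom phi p -> time_dom T t -> chart_dom psi (F p t) ->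
    row_free (dF (local_rep phi psi F) t (chart_fun phi p));
  mcf_flow : forall phi psi p t, atlas SM phi -> atlas SN psi ->
    chart_dom phi p -> time_dom T t -> chart_dom psi (F p t) ->
    forall a : 'I_n,
      ddt T (fun s => local_rep phi psi F s (chart_fun phi p) 0 a) t =
      mean_curvature (metric_mx g psi) (local_rep phi psi F) a t
        (chart_fun phi p) }.

(* Main.v *)
Require Import Defs.
From HB Require Import structures.
From mathcomp Require Import all_boot all_order all_algebra.
From mathcomp Require Import all_classical all_reals all_analysis.
From mathcomp Require Import ring.
Import Order.TTheory GRing.Theory Num.Theory.
Import numFieldNormedType.Exports.
Local Open Scope classical_set_scope.
Local Open Scope ring_scope.

(** The identity is local and comes from the equation dF/dt = H alone.  In
    charts F is a smooth map f of (x, t), so that every quantity below is a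
    smooth function of (x, t) near the given point, H is the velocity df/dt and
    d/dt is an ordinary partial derivative (a right derivative at t = 0, which
    agrees with the derivative of the smooth extension of F).

    Differentiate A = f_ij - Gamma^k_ij f_k + Gamma^a_bc f^b_i f^c_j in t.
    Since partial derivatives commute, d/dt f_ij = d_i d_j H and
    d/dt f_i = d_i H; the product rule on Gamma^k_ij f_k gives -C^k_ij f_k and
    one of the terms of nabla_i nabla_j H.  Expanding nabla_i nabla_j H, all
    remaining terms match by the symmetry of Gamma^a_bc in b and c, except for
    the derivatives of Gamma^a_bc of N and the terms quadratic in it: on the
    left Gamma^a_bc is differentiated along H and paired with f_i and f_j, on
    the right it is differentiated along f_i and paired with f_j and H.  The
    difference is R(H, f_i) f_j written out in Christoffel symbols.

    The cancellation is [curvature_identity], the coordinate formula for the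
    curvature is [riemann_upE], and [evolution] combines them for a map f that
    is smooth on an open set of space-time.  The analysis behind [evolution]
    is the stability of smoothness under products, inverses and composition
    ([smooth_onM], [smooth_on_invmx], [smooth_on_comp]), the chain rule
    ([is_derive_comp_rV]) and the symmetry of second derivatives
    ([smooth_on_derive_swap]).  The theorem then transports [evolution] from
    the smooth extension to F itself: at each time in [0, T) the two maps agree
    on an open set of points, and the quantities involved are local
    ([second_form_eq_on], [nabla2_eq_on], [ddt_derive]). *)

Set Implicit Arguments.
Unset Strict Implicit.
Unset Printing Implicit Defensive.

(** * Derivatives along lines *)

Lemma eq_on_near (R : realType) (V W : normedModType R) (U : set V)
    (f g : V -> W) (x : V) :
  open U -> {in U, f =1 g} -> U x -> \near x, f x = g x.
Proof.
move=> oU fg Ux; near=> y; apply: fg; rewrite inE; near: y.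
exact: open_nbhs_nbhs.
Unshelve. all: by end_near. Qed.

Lemma derive_eq_on (R : realType) (V W : normedModType R) (U : set V)
    (f g : V -> W) (x v : V) :
  open U -> {in U, f =1 g} -> U x -> 'D_v f x = 'D_v g x.
Proof. by move=> oU fg Ux; apply: near_eq_derive; exact: eq_on_near Ux. Qed.

Lemma is_derive_line (R : realType) (V W : normedModType R) (f : V -> W)
    (z v : V) (s : R) (d : W) :
  is_derive (s *: v + z) v f d -> is_derive s 1 (fun r => f (r *: v + z)) d.
Proof.
have E : (fun h : R => h^-1 *: (f ((h *: 1 + s) *: v + z) - f (s *: v + z))) =
    (fun h => h^-1 *: (f (h *: v + (s *: v + z)) - f (s *: v + z))).
  by apply/funext => h; rewrite -[h *: 1]/(h * 1) mulr1 scalerDl addrA.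
by move=> [df <-]; split; rewrite /derivable /derive /= E.
Qed.

(** The step h may have either sign, as the increment of a coordinate does;
    hence s is located by |s| <= |h| and not by an interval. *)
Lemma MVT_line (R : realType) (V : normedModType R) (f : V -> R) (z v : V)
    (h : R) :
  (forall s : R, `|s| <= `|h| -> derivable f (s *: v + z) v) ->
  exists2 s : R, `|s| <= `|h| & f (h *: v + z) - f z = h * 'D_v f (s *: v + z).
Proof.
move=> df; pose k (s : R) := f (s *: v + z).
have dk (s : R) : `|s| <= `|h| -> is_derive s 1 k ('D_v f (s *: v + z)).
  by move=> sh; apply: is_derive_line; apply: derivableP; exact: df.
have ck (a b : R) : (forall s : R, s \in `[a, b] -> `|s| <= `|h|) ->
    {within `[a, b], continuous k}.
  move=> ab; apply: derivable_within_continuous => s /ab sh.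
  by have [] := dk _ sh.
have fz : f z = k 0 by rewrite /k scale0r add0r.
rewrite fz -/(k h).
have [h0|h0] := leP 0 h.
  have ab (s : R) : s \in `[0, h] -> `|s| <= `|h|.
    by rewrite in_itv /= => /andP[s0 sh]; rewrite !ger0_norm.
  have [|s /ab sh E] := @MVT_segment R k (fun s => 'D_v f (s *: v + z)) _ _ h0 _ (ck _ _ ab).
    by move=> s sh; apply: dk; apply: ab; exact: subset_itv_oo_cc.
  by exists s => //; rewrite E subr0 mulrC.
have ab (s : R) : s \in `[h, 0] -> `|s| <= `|h|.
  by rewrite in_itv /= => /andP[s0 sh]; rewrite !ler0_norm ?lerN2 // ltW.
have [|s /ab sh E] := @MVT_segment R k (fun s => 'D_v f (s *: v + z)) _ _ (ltW h0) _ (ck _ _ ab).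
  by move=> s sh; apply: dk; apply: ab; exact: subset_itv_oo_cc.
by exists s => //; rewrite -opprB E sub0r mulrN opprK mulrC.
Qed.

(** * Functions of class C^k *)

Section Ck.
Context {R : realType}.
Implicit Types V W : normedModType R.

(** The first k levels of [smooth_on].  The recursion peels the innermost
    derivative, so that [Ck k.+1 U f] gives [Ck k U ('D_v f)] for every v, and
    closure properties follow by induction on k from the corresponding rule for
    a single derivative. At level 0 nothing is required, hence the continuity of
    k-th derivatives appears at level k + 1. *)
Fixpoint Ck (V W : normedModType R) (k : nat) (U : set V) (f : V -> W) : Prop :=
  if k is k'.+1 then
    (forall x, U x -> {for x, continuous f} /\ forall v, derivable f x v) /\
    (forall v : V, @Ck V W k' U ('D_v f))
  else True.

Lemma CkS V W k (U : set V) (f : V -> W) : Ck k.+1 U f -> Ck k U f.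
Proof. by elim: k f => [|k IH] f // [h0 h1]; split => // v; exact: IH. Qed.

Lemma iterD_rcons V W (vs : seq V) (v : V) (f : V -> W) :
  Defs.iterD (rcons vs v) f = Defs.iterD vs ('D_v f).
Proof. by rewrite /Defs.iterD -cats1 foldr_cat. Qed.

Lemma smooth_onP V W (U : set V) (f : V -> W) :
  smooth_on U f <-> forall k, Ck k U f.
Proof.
split=> [sf k|cf].
  elim: k f sf => // k IH f sf; split=> [x /(sf [::])//|v].
  by apply: IH => vs x Ux; have := sf (rcons vs v) x Ux; rewrite iterD_rcons.
move=> vs; elim/last_ind: vs f cf => [|vs v IH] f cf x Ux.
  by have [+ _] := cf 1; move=> /(_ x Ux).
by rewrite iterD_rcons; apply: IH => // k; have [_] := cf k.+1; exact.
Qed.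

Lemma Ck_eq V W k (U : set V) (f g : V -> W) :
  open U -> {in U, f =1 g} -> Ck k U f -> Ck k U g.
Proof.
move=> oU; elim: k f g => // k IH f g fg [h0 h1]; split=> [x Ux|v].
  have [cf df] := h0 x Ux; have nfg := eq_on_near oU fg Ux.
  split; last by move=> v; apply: near_eq_derivable (df v).
  rewrite /prop_for /continuous_at -(fg x) ?inE//.
  by apply: cvg_trans cf; apply: near_eq_cvg.
by apply: IH (h1 v) => x; rewrite inE => Ux; exact: (derive_eq_on _ oU fg).
Qed.

Lemma Ck_cst V W k (U : set V) (a : W) : Ck k U (fun=> a).
Proof.
elim: k a => // k IH a; split=> [x _|v].
  by split; [exact: cst_continuous|move=> v; exact: derivable_cst].
rewrite (_ : 'D_v _ = fun=> 0); first exact: IH.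
by apply/funext => x; exact: derive_cst.
Qed.

Lemma CkD V W k (U : set V) (f g : V -> W) : open U ->
  Ck k U f -> Ck k U g -> Ck k U (fun x => f x + g x).
Proof.
move=> oU; elim: k f g => // k IH f g [f0 f1] [g0 g1]; split=> [x Ux|v].
  have [cf df] := f0 x Ux; have [cg dg] := g0 x Ux.
  by split; [exact: cvgD|move=> v; exact: derivableD].
apply: (@Ck_eq _ _ _ _ (fun x => 'D_v f x + 'D_v g x)) => //; last first.
  exact: (IH _ _ (f1 v) (g1 v)).
move=> x; rewrite inE => Ux; rewrite deriveD//.
- by have [] := f0 x Ux.
- by have [] := g0 x Ux.
Qed.

(** By the product rule a derivative of f * g is a combination of products of
    functions one level lower; f and g themselves are brought down by [CkS]. *)
Lemma CkM V k (U : set V) (f g : V -> R) : open U ->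
  Ck k U f -> Ck k U g -> Ck k U (fun x => f x * g x).
Proof.
move=> oU; elim: k f g => // k IH f g cf cg.
have [f0 f1] := cf; have [g0 g1] := cg; split=> [x Ux|v].
  have [cfx df] := f0 x Ux; have [cgx dg] := g0 x Ux.
  by split; [exact: cvgM|move=> v; exact: derivableM].
apply: (@Ck_eq _ _ _ _ (fun x => f x * 'D_v g x + g x * 'D_v f x)) => //.
  move=> x; rewrite inE => Ux; rewrite deriveM//.
  - by have [] := f0 x Ux.
  - by have [] := g0 x Ux.
by apply: CkD => //; apply: IH; [exact: CkS|exact: g1|exact: CkS|exact: f1].
Qed.

Lemma Ck_sum V W k (U : set V) (I : Type) (r : seq I) (P : pred I)
    (f : I -> V -> W) : open U -> (forall i, Ck k U (f i)) ->
  Ck k U (fun x => \sum_(i <- r | P i) f i x).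
Proof.
move=> oU cf; elim: r => [|i r IH].
  rewrite (_ : (fun x : V => \sum_(i <- [::] | P i) f i x) = fun=> 0); first exact: Ck_cst.
  by apply/funext => x; rewrite big_nil.
rewrite (_ : (fun x : V => \sum_(j <- i :: r | P j) f j x) = fun x =>
  (if P i then f i x else 0) + \sum_(i <- r | P i) f i x).
  by apply: CkD => //; case: (P i) => //; exact: Ck_cst.
by apply/funext => x; rewrite big_cons; case: ifP => // _; rewrite add0r.
Qed.

Lemma Ck_prod V k (U : set V) (I : Type) (r : seq I) (P : pred I)
    (f : I -> V -> R) : open U -> (forall i, Ck k U (f i)) ->
  Ck k U (fun x => \prod_(i <- r | P i) f i x).
Proof.
move=> oU cf; elim: r => [|i r IH].
  rewrite (_ : (fun x : V => \prod_(i <- [::] | P i) f i x) = fun=> 1); first exact: Ck_cst.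
  by apply/funext => x; rewrite big_nil.
rewrite (_ : (fun x : V => \prod_(j <- i :: r | P j) f j x) = fun x =>
  (if P i then f i x else 1) * \prod_(i <- r | P i) f i x).
  by apply: CkM => //; case: (P i) => //; exact: Ck_cst.
by apply/funext => x; rewrite big_cons; case: ifP => // _; rewrite mul1r.
Qed.

(** The derivative -(1/f)(1/f) f' contains 1/f again, one level lower. *)
Lemma CkV V k (U : set V) (f : V -> R) : open U ->
  (forall x, U x -> f x != 0) -> Ck k U f -> Ck k U (fun x => (f x)^-1).
Proof.
move=> oU fN0; elim: k => // k IH cf.
have [f0 f1] := cf; split=> [x Ux|v].
  have [cfx df] := f0 x Ux.
  split; first by apply: cvgV => //; exact: fN0.
  by move=> v; apply: derivableV => //; exact: fN0.
apply: (@Ck_eq _ _ _ _ (fun x => -1 * (f x)^-1 * (f x)^-1 * 'D_v f x)) => //.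
  move=> x; rewrite inE => Ux; rewrite deriveV//; last 2 first.
  - exact: fN0.
  - by have [] := f0 x Ux.
  by rewrite -exprVn expr2 mulN1r mulNr scaleNr mulNr.
have {}IH := IH (CkS cf).
apply: CkM => //; last exact: f1.
by do 2!apply: CkM => //; exact: Ck_cst.
Qed.

Lemma Ck_coord V p q k (U : set V) (f : V -> 'M[R]_(p, q)) i j : open U ->
  Ck k U f -> Ck k U (fun x => f x i j).
Proof.
move=> oU; elim: k f => // k IH f [f0 f1]; split=> [x Ux|v].
  have [cf df] := f0 x Ux; split.
    apply: (@continuous_comp _ _ _ f (fun M => M i j)) => //.
    exact: coord_continuous.
  by move=> v; move/derivable_mxP: (df v); exact.
apply: (@Ck_eq _ _ _ _ (fun x => 'D_v f x i j)) => //; last exact: (IH _ (f1 v)).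
by move=> x; rewrite inE => Ux; rewrite derive_mx ?mxE//; have [] := f0 x Ux.
Qed.
End Ck.

(** * The chain rule *)

Lemma cvg_sum_ord (R : realType) (T : Type) (F : set_system T) (n : nat)
    (f : 'I_n -> T -> R) (l : 'I_n -> R) : Filter F ->
  (forall a, f a x @[x --> F] --> l a) ->
  (\sum_a f a x) @[x --> F] --> \sum_a l a.
Proof.
move=> FF fl; rewrite (_ : (fun x => _) = \sum_a f a).
  elim/big_ind2: _ => // [|g p h q]; first exact: cvg_cst.
  exact: cvgD.
by apply/funext => x; rewrite fct_sumE.
Qed.

Lemma sub_ball_rV (R : realType) (n : nat) (y z w : 'rV[R]_n) (e : R) :
  (forall b, `|w 0 b - y 0 b| <= `|z 0 b - y 0 b|) -> ball y e z -> ball y e w.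
Proof.
move=> wz [e0 yz]; split=> // i b; have := yz i b; rewrite !ord1 /ball /=.
by rewrite distrC => /(le_lt_trans (wz b)); rewrite distrC.
Qed.

(** Caratheodory's form of differentiability, for functions with continuous
    partial derivatives.  Going from y to z one coordinate at a time, the mean
    value theorem on each edge produces the value of a partial derivative at an
    intermediate point; phi a z is that value, and it is continuous at y because
    the coordinates of the intermediate point are no farther from those of y
    than the coordinates of z are. *)
Lemma hadamard (R : realType) (n : nat) (O : set 'rV[R]_n) (g : 'rV[R]_n -> R)
    (y : 'rV[R]_n) : open O -> O y ->
  (forall z a, O z -> derivable g z (delta_mx 0 a)) ->
  (forall a, {for y, continuous ('D_(delta_mx 0 a) g)}) ->
  exists2 phi : 'I_n -> 'rV[R]_n -> R,
    forall a, phi a z @[z --> y] --> 'D_(delta_mx 0 a) g y &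
    \forall z \near y, g z - g y = \sum_a (z 0 a - y 0 a) * phi a z.
Proof.
move=> oO Oy dg cg.
have /nbhs_ballP[r /= r0 rO] : nbhs y O by exact: open_nbhs_nbhs.
(* the corners of a path from y to z that changes one coordinate at a time *)
pose p (z : 'rV[R]_n) (k : nat) : 'rV[R]_n :=
  \row_b (if (b < k)%N then z 0 b else y 0 b).
have pS (z : 'rV[R]_n) (a : 'I_n) : p z a.+1 = (z 0 a - y 0 a) *: delta_mx 0 a + p z a.
  apply/rowP => b; rewrite !mxE eqxx /= ltnS leq_eqVlt (inj_eq val_inj).
  by case: eqVneq => [->|ba] /=; rewrite ?ltnn ?mulr1 ?mulr0 ?add0r ?subrK.
have pdist (z : 'rV[R]_n) (a : 'I_n) (s : R) b : `|s| <= `|z 0 a - y 0 a| ->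
    `|(s *: delta_mx 0 a + p z a) 0 b - y 0 b| <= `|z 0 b - y 0 b|.
  move=> sz; rewrite !mxE eqxx /=; case: eqVneq => [->|ba] /=.
    by rewrite ltnn mulr1 addrK.
  by rewrite mulr0 add0r; case: ifP => //; rewrite subrr normr0.
have step (za : 'rV[R]_n * 'I_n) : exists s : R,
    `|s| <= `|za.1 0 za.2 - y 0 za.2| /\ (ball y r za.1 ->
    g (p za.1 za.2.+1) - g (p za.1 za.2) = (za.1 0 za.2 - y 0 za.2) *
      'D_(delta_mx 0 za.2) g (s *: delta_mx 0 za.2 + p za.1 za.2)).
  case: za => z a /=; have [yz|yz] := pselect (ball y r z); last first.
    by exists 0; rewrite normr0.
  have [|s sz E] := @MVT_line R _ g (p z a) (delta_mx 0 a) (z 0 a - y 0 a).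
    by move=> s sz; apply: dg; apply: rO; apply: sub_ball_rV yz => b; exact: pdist.
  by exists s; split => // _; rewrite pS.
have [S SP] := choice step.
pose q z a := S (z, a) *: delta_mx 0 a + p z a.
have cq a : q z a @[z --> y] --> y.
  move=> P /nbhs_ballP[e e0 eP].
  rewrite nbhs_simpl /=; apply/nbhs_ballP; exists e => // z yz; apply: eP.
  by apply: sub_ball_rV yz => b; apply: pdist; have [] := SP (z, a).
exists (fun a z => 'D_(delta_mx 0 a) g (q z a)) => [a|].
  exact: cvg_comp (cq a) (cg a).
have p0 z : p z 0%N = y by apply/rowP => b; rewrite !mxE.
have pn z : p z n = z by apply/rowP => b; rewrite !mxE ltn_ord.
near=> z; have yz : ball y r z by near: z; exact: nbhsx_ballx.
(* the edges of the path from p z 0 = y to p z n = z telescope *)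
rewrite -{1}(pn z) -{1}(p0 z) -(telescope_sumr (fun k => g (p z k))) //.
rewrite big_mkord; apply: eq_bigr => a _.
by have [_ /(_ yz)] := SP (z, a).
Unshelve. all: by end_near. Qed.

(** The difference quotient of g o f is, by [hadamard], the sum of the
    difference quotients of the components of f times phi a (f (x + h v)). *)
Lemma is_derive_comp_rV (R : realType) (V : normedModType R) (n : nat)
    (O : set 'rV[R]_n) (g : 'rV[R]_n -> R) (f : V -> 'rV[R]_n) (x v : V) :
  open O -> O (f x) ->
  (forall z a, O z -> derivable g z (delta_mx 0 a)) ->
  (forall a, {for f x, continuous ('D_(delta_mx 0 a) g)}) ->
  {for x, continuous f} -> derivable f x v ->
  is_derive x v (g \o f)
    (\sum_a 'D_v (fun z => f z 0 a) x * 'D_(delta_mx 0 a) g (f x)).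
Proof.
move=> oO Ofx dg cg cf df; have [phi cphi E] := hadamard oO Ofx dg cg.
have cx : h *: v + x @[h --> (0 : R)^'] --> x.
  apply: cvg_within_filter; rewrite -{2}[x]add0r -(scale0r v).
  by apply: cvgD; [apply: cvgZr_tmp; exact: cvg_id|exact: cvg_cst].
have cfx : f (h *: v + x) @[h --> (0 : R)^'] --> f x := cvg_comp _ _ cx cf.
have lim : h^-1 *: (g (f (h *: v + x)) - g (f x)) @[h --> (0 : R)^'] -->
   \sum_a 'D_v (fun z => f z 0 a) x * 'D_(delta_mx 0 a) g (f x).
  have : \sum_a (h^-1 *: (f (h *: v + x) 0 a - f x 0 a)) * phi a (f (h *: v + x))
     @[h --> (0 : R)^'] -->
     \sum_a 'D_v (fun z => f z 0 a) x * 'D_(delta_mx 0 a) g (f x).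
    apply: cvg_sum_ord => a; apply: cvgM; last exact: (cvg_comp _ _ cfx (cphi a)).
    by move/derivable_mxP: df => /(_ 0 a).
  apply: cvg_trans; apply: near_eq_cvg.
  have := cfx _ E; rewrite nbhs_filterE /= => nE; near=> h.
  have -> : g (f (h *: v + x)) - g (f x) =
    \sum_a (f (h *: v + x) 0 a - f x 0 a) * phi a (f (h *: v + x)).
    by near: h.
  by rewrite scaler_sumr; apply: eq_bigr => a _; rewrite scalerAl.
split; first by apply/cvg_ex; eexists; exact: lim.
exact: cvg_lim lim.
Unshelve. all: by end_near. Qed.

(** Only coordinate directions are needed in the target: the derivative of
    g o f is a combination of the partial derivatives of g composed with f.
    One more level is asked of g because the chain rule uses the continuity of
    its first derivatives. *)
Lemma Ck_comp (R : realType) (V : normedModType R) (n k : nat) (U : set V)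
    (O : set 'rV[R]_n) (g : 'rV[R]_n -> R) (f : V -> 'rV[R]_n) :
  open U -> open O -> (forall x, U x -> O (f x)) ->
  Ck k.+1 O g -> Ck k U f -> Ck k U (g \o f).
Proof.
move=> oU oO UO; elim: k g => // k IH g cg cf.
have [g0 g1] := cg; have [f0 f1] := cf.
have dgf x v : U x -> is_derive x v (g \o f)
    (\sum_a 'D_v (fun z => f z 0 a) x * 'D_(delta_mx 0 a) g (f x)).
  move=> Ux; have [cfx dfx] := f0 x Ux.
  apply: (is_derive_comp_rV oO) => //; first exact: UO.
    by move=> z a /g0[].
  by move=> a; have [+ _] := g1 (delta_mx 0 a); move=> /(_ (f x) (UO _ Ux))[].
split=> [x Ux|v].
  split; last by move=> v; have [] := dgf x v Ux.
  have [cfx _] := f0 x Ux; have [cgx _] := g0 _ (UO _ Ux).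
  exact: continuous_comp.
apply: (@Ck_eq _ _ _ _ _
  (fun x => \sum_a 'D_v (fun z => f z 0 a) x * ('D_(delta_mx 0 a) g \o f) x)) => //.
  by move=> x; rewrite inE => Ux; have [_ ->] := dgf x v Ux.
apply: Ck_sum => // a; apply: CkM => //; last first.
  by apply: IH; [exact: g1|exact: CkS].
apply: (@Ck_eq _ _ _ _ _ (fun x => 'D_v f x 0 a)) => //.
  by move=> x; rewrite inE => Ux; rewrite derive_mx ?mxE//; have [] := f0 x Ux.
by apply: Ck_coord => //; exact: f1.
Qed.

(** * Symmetry of second derivatives *)

Lemma near_parallelogram (R : realType) (V : normedModType R) (x v w : V)
    (P : set V) : nbhs x P -> exists2 h : R, 0 < h &
  forall a b : R, `|a| <= h -> `|b| <= h -> P (a *: v + (b *: w + x)).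
Proof.
move=> /nbhs_ballP[r /= r0 rP]; pose K := `|v| + `|w| + 1.
have K0 : 0 < K by rewrite ltr_wpDl// addr_ge0.
exists (r / K) => [|a b ah bh]; first exact: divr_gt0.
apply: rP; rewrite -ball_normE /ball_ /= addrA opprD addrCA subrr addr0 normrN.
apply: (@le_lt_trans _ _ (r / K * (`|v| + `|w|))).
  by rewrite mulrDr (le_trans (ler_normD _ _))// !normrZ lerD// ler_wpM2r.
rewrite -mulrA gtr_pMr// mulrC ltr_pdivrMr// mul1r ltrDl//.
Qed.

Lemma is_derive_translate (R : realType) (V W : normedModType R) (f : V -> W)
    (c z v : V) (d : W) :
  is_derive (c + z) v f d -> is_derive z v (fun y => f (c + y)) d.
Proof.
have E : (fun h : R => h^-1 *: (f (c + (h *: v + z)) - f (c + z))) =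
    (fun h => h^-1 *: (f (h *: v + (c + z)) - f (c + z))).
  by apply/funext => h; rewrite addrCA.
by move=> [df <-]; split; rewrite /derivable /derive /= E.
Qed.

(** Two mean value theorems in a row, one along v for the difference
    f (h w + z) - f z and one along w for 'D_v f.  The left-hand side is
    symmetric in v and w, up to the order of its terms. *)
Lemma second_difference (R : realType) (V : normedModType R) (U : set V)
    (f : V -> R) (x v w : V) (h : R) : 0 < h -> Ck 2 U f ->
  (forall a b : R, `|a| <= h -> `|b| <= h -> U (a *: v + (b *: w + x))) ->
  exists a b : R, [/\ `|a| <= h, `|b| <= h &
    f (h *: v + (h *: w + x)) - f (h *: v + x) - (f (h *: w + x) - f x) =
    h * (h * 'D_w ('D_v f) (a *: v + (b *: w + x)))].
Proof.
move=> h0 [f0 f1] Uab; have hh : `|h| <= h by rewrite ger0_norm// ltW.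
have h0' : `|0 : R| <= h by rewrite normr0 ltW.
pose F z := f (h *: w + z) - f z.
have dF (a : R) : `|a| <= h ->
    is_derive (a *: v + x) v F
      ('D_v f (h *: w + (a *: v + x)) - 'D_v f (a *: v + x)).
  move=> ah; have := Uab a h ah hh; have := Uab a 0 ah h0'.
  rewrite scale0r add0r => U0 U1; apply: is_deriveB.
    apply: is_derive_translate; apply: derivableP.
    by have [_] := f0 _ U1; rewrite addrCA.
  by apply: derivableP; have [_] := f0 _ U0.
have [|a ah Ea] := @MVT_line R V F x v h.
  by move=> s sh; have [] := dF s (le_trans sh hh).
have {}ah := le_trans ah hh.
have [|b bh Eb] := @MVT_line R V ('D_v f) (a *: v + x) w h.
  move=> s sh; have [+ _] := f1 v => /(_ (s *: w + (a *: v + x))).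
  by rewrite (addrCA (s *: w)) => /(_ (Uab _ _ ah (le_trans sh hh)))[].
have {}bh := le_trans bh hh.
exists a, b; split=> //; rewrite (addrCA (a *: v)) -Eb.
by have [_ <-] := dF a ah; rewrite -Ea /F [h *: v + (_ + _)]addrCA.
Qed.

(** Schwarz's theorem: the second difference at scale h is h^2 times either
    mixed derivative at points that tend to x with h. *)
Lemma derive_swap (R : realType) (V : normedModType R) (U : set V)
    (f : V -> R) (x v w : V) : open U -> U x -> Ck 3 U f ->
  'D_v ('D_w f) x = 'D_w ('D_v f) x.
Proof.
move=> oU Ux cf; apply/eqP; rewrite -subr_eq0 -normr_le0.
apply/ler_addgt0Pl => e e0; rewrite addr0.
have tri (p q r : R) : `|p - r| < e / 2 -> `|q - r| < e / 2 -> `|p - q| <= e.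
  move=> pr qr; rewrite -(subrKA r) (le_trans (ler_normD _ _))// [leRHS]splitr.
  by rewrite lerD ?ltW// distrC.
have near_cts v1 w1 :
    \forall z \near x, `|'D_v1 ('D_w1 f) x - 'D_v1 ('D_w1 f) z| < e / 2.
  have [_ /(_ w1)[_ /(_ v1)[+ _]]] := cf => /(_ x Ux)[+ _].
  by move/cvgrPdist_lt; apply; rewrite divr_gt0.
have [h h0 hP] := near_parallelogram v w (filterI (open_nbhs_nbhs (conj oU Ux))
  (filterI (near_cts v w) (near_cts w v))).
have [|a [b [ah bh E1]]] := second_difference h0 (CkS cf) (x := x) (v := v) (w := w).
  by move=> a b ah bh; case: (hP a b ah bh).
have [|b' [a' [bh' ah' E2]]] := second_difference h0 (CkS cf) (x := x) (v := w) (w := v).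
  by move=> b' a' bh' ah'; rewrite addrCA; case: (hP a' b' ah' bh').
have [_ [_ /= nB]] := hP a b ah bh.
have [_ [/= nA _]] := hP a' b' ah' bh'.
move: E2; rewrite (addrCA (b' *: w)) => E2.
have swapB (p q r s : R) : p - q - (r - s) = p - r - (q - s) by ring.
have E : 'D_w ('D_v f) (a *: v + (b *: w + x)) =
         'D_v ('D_w f) (a' *: v + (b' *: w + x)).
  have h0' : h != 0 by rewrite gt_eqF.
  apply: (mulfI h0'); apply: (mulfI h0'); rewrite -[LHS]E1 -[RHS]E2.
  by rewrite (addrCA (h *: w)); exact: swapB.
by move: nB; rewrite E; exact: tri.
Qed.

(** * Smooth functions *)

Section SmoothOn.
Context {R : realType}.
Implicit Types V W : normedModType R.

Lemma smooth_on_is_derive V W (U : set V) (f : V -> W) x v :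
  smooth_on U f -> U x -> is_derive x v f ('D_v f x).
Proof.
by move=> sf Ux; apply: derivableP; have [_] := sf [::] x Ux; exact.
Qed.

Lemma smooth_on_continuous V W (U : set V) (f : V -> W) x :
  smooth_on U f -> U x -> {for x, continuous f}.
Proof. by move=> sf Ux; have [] := sf [::] x Ux. Qed.

Lemma smooth_on_sub V W (U U' : set V) (f : V -> W) :
  U' `<=` U -> smooth_on U f -> smooth_on U' f.
Proof. by move=> UU sf vs x /UU; exact: sf. Qed.

Lemma smooth_on_derive V W (U : set V) (f : V -> W) v :
  smooth_on U f -> smooth_on U ('D_v f).
Proof. move=> /smooth_onP sf; apply/smooth_onP => k; by have [_] := sf k.+1; exact. Qed.

Lemma smooth_on_eq V W (U : set V) (f g : V -> W) : open U ->
  {in U, f =1 g} -> smooth_on U f -> smooth_on U g.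
Proof.
by move=> oU fg /smooth_onP sf; apply/smooth_onP => k; exact: Ck_eq (sf k).
Qed.

Lemma smooth_on_cst V W (U : set V) (a : W) : smooth_on U (fun=> a).
Proof. by apply/smooth_onP => k; exact: Ck_cst. Qed.

Lemma smooth_onD V W (U : set V) (f g : V -> W) : open U ->
  smooth_on U f -> smooth_on U g -> smooth_on U (fun x => f x + g x).
Proof.
by move=> oU /smooth_onP sf /smooth_onP sg; apply/smooth_onP => k; exact: CkD.
Qed.

Lemma smooth_onM V (U : set V) (f g : V -> R) : open U ->
  smooth_on U f -> smooth_on U g -> smooth_on U (fun x => f x * g x).
Proof.
by move=> oU /smooth_onP sf /smooth_onP sg; apply/smooth_onP => k; exact: CkM.
Qed.

Lemma smooth_onB V (U : set V) (f g : V -> R) : open U ->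
  smooth_on U f -> smooth_on U g -> smooth_on U (fun x => f x - g x).
Proof.
move=> oU sf sg.
have -> : (fun x => f x - g x) = (fun x => f x + -1 * g x).
  by apply/funext => x; rewrite mulN1r.
exact: smooth_onD oU sf (smooth_onM oU (@smooth_on_cst _ _ _ _) sg).
Qed.

Lemma smooth_on_sum V W (U : set V) (I : Type) (r : seq I) (P : pred I)
    (f : I -> V -> W) : open U -> (forall i, smooth_on U (f i)) ->
  smooth_on U (fun x => \sum_(i <- r | P i) f i x).
Proof.
move=> oU sf; apply/smooth_onP => k; apply: Ck_sum => // i.
by have/smooth_onP := sf i; exact.
Qed.

Lemma smooth_on_prod V (U : set V) (I : Type) (r : seq I) (P : pred I)
    (f : I -> V -> R) : open U -> (forall i, smooth_on U (f i)) ->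
  smooth_on U (fun x => \prod_(i <- r | P i) f i x).
Proof.
move=> oU sf; apply/smooth_onP => k; apply: Ck_prod => // i.
by have/smooth_onP := sf i; exact.
Qed.

Lemma smooth_onV V (U : set V) (f : V -> R) : open U ->
  (forall x, U x -> f x != 0) -> smooth_on U f ->
  smooth_on U (fun x => (f x)^-1).
Proof.
by move=> oU f0 /smooth_onP sf; apply/smooth_onP => k; exact: CkV.
Qed.

Lemma smooth_on_coord V p q (U : set V) (f : V -> 'M[R]_(p, q)) i j : open U ->
  smooth_on U f -> smooth_on U (fun x => f x i j).
Proof.
by move=> oU /smooth_onP sf; apply/smooth_onP => k; exact: Ck_coord.
Qed.

Lemma smooth_on_comp V (n : nat) (U : set V) (O : set 'rV[R]_n)
    (g : 'rV[R]_n -> R) (f : V -> 'rV[R]_n) :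
  open U -> open O -> (forall x, U x -> O (f x)) ->
  smooth_on O g -> smooth_on U f -> smooth_on U (fun x => g (f x)).
Proof.
move=> oU oO UO /smooth_onP sg /smooth_onP sf; apply/smooth_onP => k.
exact: Ck_comp (sg _) (sf _).
Qed.

Lemma is_derive_smooth_comp V (n : nat) (U : set V) (O : set 'rV[R]_n)
    (g : 'rV[R]_n -> R) (f : V -> 'rV[R]_n) (x v : V) :
  open O -> O (f x) -> smooth_on O g -> smooth_on U f -> U x ->
  is_derive x v (fun y => g (f y))
    (\sum_a 'D_v (fun z => f z 0 a) x * 'D_(delta_mx 0 a) g (f x)).
Proof.
move=> oO Ofx sg sf Ux; apply: (is_derive_comp_rV oO) => //.
- by move=> z a Oz; have [] := smooth_on_is_derive (delta_mx 0 a) sg Oz.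
- by move=> a; exact: smooth_on_continuous (smooth_on_derive _ sg) Ofx.
- exact: smooth_on_continuous sf Ux.
- by have [] := smooth_on_is_derive v sf Ux.
Qed.

Lemma smooth_on_derive_swap V (U : set V) (f : V -> R) (x v w : V) :
  open U -> smooth_on U f -> U x -> 'D_v ('D_w f) x = 'D_w ('D_v f) x.
Proof. by move=> oU /smooth_onP sf Ux; exact: derive_swap (sf 3). Qed.

Lemma smooth_on_det V (n : nat) (U : set V) (A : V -> 'M[R]_n) : open U ->
  (forall i j, smooth_on U (fun x => A x i j)) ->
  smooth_on U (fun x => \det (A x)).
Proof.
move=> oU sA; rewrite /determinant; apply: smooth_on_sum => // s.
apply: smooth_onM => //; first exact: smooth_on_cst.
by apply: smooth_on_prod => // i; exact: sA.
Qed.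

(** Cramer's rule: the entries are quotients of determinants, and determinants
    are polynomials in the entries. *)
Lemma smooth_on_invmx V (n : nat) (U : set V) (A : V -> 'M[R]_n) k l : open U ->
  (forall x, U x -> A x \in unitmx) ->
  (forall i j, smooth_on U (fun x => A x i j)) ->
  smooth_on U (fun x => invmx (A x) k l).
Proof.
move=> oU uA sA.
apply: (@smooth_on_eq _ _ _ (fun x => (\det (A x))^-1 *
   ((-1) ^+ (l + k) * \det (\matrix_(i, j) A x (lift l i) (lift k j))))) => //.
  move=> x; rewrite inE => Ux; rewrite /invmx uA// !mxE /cofactor.
  by congr (_ * (_ * \det _)); apply/matrixP => i j; rewrite !mxE.
apply: smooth_onM => //.
  apply: smooth_onV => // [x Ux|]; last exact: smooth_on_det.
  by have := uA x Ux; rewrite unitmxE unitfE.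
apply: smooth_onM => //; first exact: smooth_on_cst.
apply: smooth_on_det => // i j.
rewrite (_ : (fun x => _) = fun x => A x (lift l i) (lift k j)) //.
by apply/funext => x; rewrite mxE.
Qed.

(** The next four lemmas restate the rules of calculus for functions written
    as lambda terms, so that they apply to formulas in coordinates. *)
Lemma is_derive_add V (f g : V -> R) x v a b :
  is_derive x v f a -> is_derive x v g b ->
  is_derive x v (fun y => f y + g y) (a + b).
Proof. by move=> df dg; exact: is_deriveD. Qed.

Lemma is_derive_sub V (f g : V -> R) x v a b :
  is_derive x v f a -> is_derive x v g b ->
  is_derive x v (fun y => f y - g y) (a - b).
Proof. by move=> df dg; exact: is_deriveB. Qed.

Lemma is_derive_mul V (f g : V -> R) x v a b :
  is_derive x v f a -> is_derive x v g b ->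
  is_derive x v (fun y => f y * g y) (a * g x + f x * b).
Proof.
move=> df dg; have [dfg E] := is_deriveM df dg; split; first exact: dfg.
by rewrite [LHS]E addrC -[g x *: a]/(g x * a) (mulrC (g x)).
Qed.

Lemma is_derive_bigsum V (n : nat) (f : 'I_n -> V -> R) x v d :
  (forall i, is_derive x v (f i) (d i)) ->
  is_derive x v (fun y => \sum_i f i y) (\sum_i d i).
Proof.
move=> df; rewrite (_ : (fun y => _) = \sum_i f i); first exact: is_derive_sum.
by apply/funext => y; rewrite fct_sumE.
Qed.

End SmoothOn.

(** * Space slices and the one-sided time derivative *)

Lemma pd_slice (R : realType) (m : nat) (f : 'rV[R]_m * R -> R) (i : 'I_m)
    (x : 'rV[R]_m) (s : R) :
  pd i (fun z => f (z, s)) x = 'D_(delta_mx 0 i, 0) f (x, s).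
Proof.
rewrite /pd /derive.
suff -> : (fun h : R => h^-1 *:
      (((fun z => f (z, s)) \o shift x) (h *: delta_mx 0 i) - f (x, s))) =
    (fun h => h^-1 *:
      ((f \o shift (x, s)) (h *: (delta_mx 0 i, 0)) - f (x, s))) by [].
apply/funext => h /=.
have -> // : h *: (delta_mx 0 i : 'rV[R]_m, 0 : R) + (x, s) = (h *: delta_mx 0 i + x, s).
by congr (_, _); rewrite /= scaler0 add0r.
Qed.

(** Points of [0, T) accumulate at t from the right, also when t = 0; so the
    limit that defines [ddt] is unique. *)
Lemma time_dom_proper (R : realType) (T : \bar R) (t : R) :
  time_dom T t -> ProperFilter (within (time_dom T) t^').
Proof.
move=> [t0 tT]; suff ex P : within (time_dom T) t^' P -> exists s, P s.
  exact: (Build_ProperFilter_ex ex (within_filter _ _)).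
move=> nP.
have nT : \forall s \near t^'+, (s%:E < T)%E.
  case: T tT {nP} => [r|_|//]; last by near=> s; rewrite ltry.
  by rewrite lte_fin => tr; near=> s; rewrite lte_fin; near: s; exact: nbhs_right_lt.
have nP' : \forall s \near t^'+, time_dom T s -> P s.
  move: nP; rewrite /within /= !near_withinE /= => nP.
  by apply: filterS nP => s Ps ts; apply: Ps; rewrite gt_eqF.
have : \forall s \near t^'+, P s.
  near=> s.
  have ts : t < s by [].
  have : time_dom T s by split; [exact: (le_trans t0 (ltW _))|near: s].
  by near: s.
by move=> H; case: (@filter_ex _ _ (at_right_proper_filter t) _ H) => s Hs; exists s.
Unshelve. all: by end_near. Qed.

(** The derivative in [ddt] only sees times in [0, T); any extension f that
    agrees with h there and is differentiable in time computes it. *)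
Lemma ddt_derive (R : realType) (m : nat) (T : \bar R) (h : R -> R)
    (f : 'rV[R]_m * R -> R) (x : 'rV[R]_m) (t d : R) : time_dom T t ->
  is_derive (x, t) (0, 1) f d ->
  (\forall s \near t, time_dom T s -> h s = f (x, s)) -> ddt T h t = d.
Proof.
move=> tT df hf; have PF := time_dom_proper tT.
apply: cvg_lim => //.
have ht : h t = f (x, t) by have := nbhs_singleton hf; exact.
have df' : (s - t)^-1 * (f (x, s) - f (x, t)) @[s --> t^'] --> d.
  have ct : s - t @[s --> t^'] --> (0 : R)^'.
    move=> P; rewrite /dnbhs /within /= !nbhs_simpl /= => nP.
    have : s - t @[s --> t] --> (0 : R).
      by rewrite -[X in _ --> X](subrr t); apply: cvgB; [exact: cvg_id|exact: cvg_cst].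
    move/(_ _ nP); rewrite nbhs_simpl /=; apply: filterS => s Ps st.
    by apply: Ps; rewrite subr_eq0.
  have [dcv dE] := df.
  have : k^-1 *: (f (k *: (0, 1) + (x, t)) - f (x, t)) @[k --> (0 : R)^'] --> d.
    by rewrite -dE; exact: dcv.
  move/(cvg_comp _ _ ct); apply: cvg_trans.
  rewrite (_ : (fun s => _) =
    (fun k => k^-1 *: (f (k *: (0, 1) + (x, t)) - f (x, t))) \o
    (fun s => s - t)) //.
  apply/funext => s /=; congr (_ * (f _ - _)).
  by congr (_, _); rewrite /= ?scaler0 ?add0r// -[_ *: 1]/(_ * 1) mulr1 subrK.
have : (s - t)^-1 * (f (x, s) - f (x, t)) @[s --> within (time_dom T) t^'] --> d.
  exact: cvg_trans (cvg_app _ (cvg_within _)) df'.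
apply: cvg_trans; apply: near_eq_cvg; rewrite /within /=.
have hf' : \forall s \near t^', time_dom T s -> h s = f (x, s).
  by apply: cvg_within; exact: hf.
by apply: filterS hf' => s hs Ts; rewrite hs// ht.
Qed.

Lemma open_setI_preimage (S T : topologicalType) (U : set S) (B : set T)
    (f : S -> T) : open U -> open B ->
  (forall x, U x -> {for x, continuous f}) -> open (U `&` f @^-1` B).
Proof.
move=> oU oB cf; rewrite openE => x [Ux Bfx]; apply: filterI.
  exact: open_nbhs_nbhs.
by apply: cf => //; exact: open_nbhs_nbhs.
Qed.

Lemma open_slicel (S T : topologicalType) (U : set (S * T)%type) (t : T) :
  open U -> open [set x | U (x, t)].
Proof.
move=> oU; have := open_setI_preimage (f := fun x : S => (x, t)) openT oU.
rewrite setTI; apply => x _.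
by apply: cvg_pair; [exact: cvg_id|exact: cvg_cst].
Qed.

Lemma near_slicer (S T : topologicalType) (U : set (S * T)%type) (x : S) (t : T) :
  open U -> U (x, t) -> \forall s \near t, U (x, s).
Proof.
move=> oU Uxt; have ct : (x, s) @[s --> t] --> (x, t).
  by apply: cvg_pair; [exact: cvg_cst|exact: cvg_id].
by apply: ct; exact: open_nbhs_nbhs.
Qed.

(** * Christoffel symbols and curvature *)

Lemma christoffelC (R : realType) (d : nat) (O : set 'rV[R]_d)
    (g : 'rV[R]_d -> 'M[R]_d) k i j y : open O -> O y ->
  (forall z, O z -> (g z)^T = g z) -> christoffel g k i j y = christoffel g k j i y.
Proof.
move=> oO Oy symg; rewrite /christoffel; congr (_ * _); apply: eq_bigr => l _.
congr (_ * _); congr (_ - _); first by rewrite addrC.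
apply: (derive_eq_on _ oO) => // z; rewrite inE => Oz.
by rewrite -[in LHS]symg// mxE.
Qed.

Lemma smooth_on_christoffel (R : realType) (d : nat) (O : set 'rV[R]_d)
    (g : 'rV[R]_d -> 'M[R]_d) k i j : open O -> smooth_on O g ->
  (forall z, O z -> g z \in unitmx) -> smooth_on O (christoffel g k i j).
Proof.
move=> oO sg ug.
have spd a b c : smooth_on O (pd a (fun z => g z b c)).
  exact: smooth_on_derive (smooth_on_coord _ _ oO sg).
apply: smooth_onM => //; first exact: smooth_on_cst.
apply: smooth_on_sum => // l; apply: smooth_onM => //.
  by apply: smooth_on_invmx => // a b; exact: smooth_on_coord.
by apply: smooth_onB => //; exact: smooth_onD.
Qed.

Section Curvature.
Context {R : realType} {n : nat} (G : 'rV[R]_n -> 'M[R]_n).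
Local Notation Gam a b c := (christoffel G a b c).

Lemma sum_coord_field c (F : 'I_n -> R) (y : 'rV[R]_n) :
  \sum_b coord_field c y 0 b * F b = F c.
Proof.
rewrite (bigD1 c)//= [X in _ + X]big1 => [|b bc].
  by rewrite mxE !eqxx mul1r addr0.
by rewrite mxE (negbTE bc) andbF mul0r.
Qed.

Lemma lc_connection_coordl c (Y : 'rV[R]_n -> 'rV[R]_n) y :
  lc_connection G (@coord_field R n c) Y y =
  \row_a (pd c (fun z => Y z 0 a) y + \sum_e Gam a c e y * Y y 0 e).
Proof. by apply/rowP => a; rewrite !mxE sum_coord_field. Qed.

Lemma lc_connection_coord c d y :
  lc_connection G (@coord_field R n c) (@coord_field R n d) y = \row_a Gam a c d y.
Proof.
rewrite lc_connection_coordl; apply/rowP => a; rewrite !mxE.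
rewrite [X in X + _](_ : _ = 0) ?add0r; last exact: derive_cst.
under eq_bigr do rewrite mulrC.
exact: (sum_coord_field d (fun e => Gam a c e y) y).
Qed.

(** Coordinate fields commute, so the third term of the curvature vanishes,
    and each of the other two differentiates a Christoffel symbol once. *)
Lemma curvature_coord c d b y :
  curvature G (@coord_field R n c) (@coord_field R n d) (@coord_field R n b) y =
  \row_a (pd c (Gam a d b) y - pd d (Gam a c b) y
    + \sum_e Gam a c e y * Gam e d b y - \sum_e Gam a d e y * Gam e c b y).
Proof.
have -> : curvature G (@coord_field R n c) (@coord_field R n d) (@coord_field R n b) y =
    lc_connection G (@coord_field R n c) (fun z => \row_a Gam a d b z) y -
    lc_connection G (@coord_field R n d) (fun z => \row_a Gam a c b z) y.
  rewrite /curvature; have E e : lc_connection G (@coord_field R n e) (@coord_field R n b) =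
      fun z => \row_a Gam a e b z by apply/funext => z; exact: lc_connection_coord.
  rewrite !E [X in _ - X](_ : _ = 0) ?subr0//.
  apply/rowP => a; rewrite !mxE [RHS]mxE big1// => e _; rewrite mxE big1 ?mul0r// => e' _.
  by rewrite /pd !derive_cst !mulr0 subrr.
rewrite !lc_connection_coordl; apply/rowP => a; rewrite !mxE.
have E e f : (fun z => (\row_a0 Gam a0 e f z) 0 a) = Gam a e f.
  by apply/funext => z; rewrite mxE.
rewrite !E.
under eq_bigr do rewrite mxE; under [X in _ - (_ + X)]eq_bigr do rewrite mxE.
have shuffle (p q r s : R) : p + q - (r + s) = p - r + q - s by ring.
exact: shuffle.
Qed.

(** Lowering the first index with g and raising it again does nothing. *)
Lemma riemann_upE a b c d y : G y \in unitmx ->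
  riemann_up G a b c d y =
    pd c (Gam a d b) y - pd d (Gam a c b) y
    + \sum_e Gam a c e y * Gam e d b y - \sum_e Gam a d e y * Gam e c b y.
Proof.
move=> uG; rewrite /riemann_up /riemann_down.
set r := curvature _ _ _ _ _.
have -> : \sum_e invmx (G y) a e * (coord_field e y *m G y *m r^T) 0 0 =
    (invmx (G y) *m (G y *m r^T)) a 0.
  rewrite [RHS]mxE; apply: eq_bigr => e _; congr (_ * _).
  by rewrite -mulmxA -rowE mxE.
by rewrite mulKmx// mxE /r curvature_coord mxE.
Qed.
End Curvature.

(** * Positive definiteness of the induced metric *)

Section PositiveDefinite.
Context {R : realType} {m n : nat}.

Lemma posdef_unitmx (A : 'M[R]_n) :
  (forall v : 'rV[R]_n, v != 0 -> 0 < (v *m A *m v^T) 0 0) -> A \in unitmx.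
Proof.
move=> Apos; rewrite -row_free_unit; apply/inj_row_free => v vA0.
by apply/eqP/negPn/negP => /Apos; rewrite vA0 mul0mx mxE ltxx.
Qed.

Lemma induced_metricE (G : 'rV[R]_n -> 'M[R]_n) (u : R -> 'rV[R]_m -> 'rV[R]_n) t x :
  induced_metric G u t x = dF u t x *m G (u t x) *m (dF u t x)^T.
Proof.
apply/matrixP => i j; rewrite !mxE exchange_big; apply: eq_bigr => b _ /=.
by rewrite !mxE mulr_suml; apply: eq_bigr => a _; rewrite !mxE [G _ _ _ * _]mulrC.
Qed.

(** The induced metric is D g D^T with D of full rank, hence has no kernel:
    v D g D^T v^T > 0 as soon as v D is nonzero. *)
Lemma induced_metric_unitmx (G : 'rV[R]_n -> 'M[R]_n)
    (u : R -> 'rV[R]_m -> 'rV[R]_n) t x : row_free (dF u t x) ->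
  (forall v : 'rV[R]_n, v != 0 -> 0 < (v *m G (u t x) *m v^T) 0 0) ->
  induced_metric G u t x \in unitmx.
Proof.
move=> fdF Gpos; rewrite induced_metricE -row_free_unit.
apply/inj_row_free => v vA0.
apply: (row_free_inj fdF); rewrite mul0mx; apply/eqP/negPn/negP => /Gpos.
by rewrite trmx_mul !mulmxA in vA0 *; rewrite vA0 mul0mx mxE ltxx.
Qed.
End PositiveDefinite.

(** * Locality of the geometric quantities *)

(** These congruences compare two coordinate formulas term by term, without
    ever testing terms in two different maps for convertibility. *)
Lemma congrD (V : zmodType) (a b a' b' : V) : a = a' -> b = b' -> a + b = a' + b'.
Proof. by move=> -> ->. Qed.

Lemma congrM (R : pzRingType) (a b a' b' : R) :
  a = a' -> b = b' -> a * b = a' * b'.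
Proof. by move=> -> ->. Qed.

Lemma congrBD (V : zmodType) (a b c a' b' c' : V) :
  a = a' -> b = b' -> c = c' -> a - b + c = a' - b' + c'.
Proof. by move=> -> -> ->. Qed.

(** All quantities are built from derivatives of u at a fixed time, so maps
    that agree at that time on an open set of points have the same ones there.
    The times enter separately since the equality with a smooth extension is
    only available at times of [0, T). *)
Section Locality.
Context {R : realType} {m n : nat} (A : set 'rV[R]_m) (oA : open A).

Lemma pd_eq_on (f g : 'rV[R]_m -> R) i x :
  (forall z, A z -> f z = g z) -> A x -> pd i f x = pd i g x.
Proof.
by move=> fg; apply: derive_eq_on => // z; rewrite inE => Az; exact: fg.
Qed.

Lemma christoffel_eq_on (g h : 'rV[R]_m -> 'M[R]_m) k i j x :
  (forall z, A z -> g z = h z) -> A x ->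
  christoffel g k i j x = christoffel h k i j x.
Proof.
move=> gh Ax; have E a b c : pd a (fun z => g z b c) x = pd a (fun z => h z b c) x.
  by apply: pd_eq_on => // z Az; rewrite gh.
rewrite /christoffel (gh x Ax); congr (_ * _); apply: eq_bigr => l _.
by rewrite !E.
Qed.

Variables (G : 'rV[R]_n -> 'M[R]_n) (u v : R -> 'rV[R]_m -> 'rV[R]_n) (t : R).
Hypothesis uv : forall z, A z -> u t z = v t z.

Lemma dF_eq_on x : A x -> dF u t x = dF v t x.
Proof.
move=> Ax; apply/matrixP => i a; rewrite !mxE; apply: pd_eq_on => // z Az.
by rewrite uv.
Qed.

Lemma induced_metric_eq_on x : A x ->
  induced_metric G u t x = induced_metric G v t x.
Proof. by move=> Ax; rewrite /induced_metric (uv Ax) (dF_eq_on Ax). Qed.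

Lemma induced_christoffel_eq_on k i j x : A x ->
  induced_christoffel G u k i j t x = induced_christoffel G v k i j t x.
Proof.
by move=> Ax; apply: christoffel_eq_on => // z Az; exact: induced_metric_eq_on.
Qed.

Lemma second_form_eq_on a i j x : A x ->
  second_form G u a i j t x = second_form G v a i j t x.
Proof.
move=> Ax; apply: congrBD; last by rewrite (uv Ax) (dF_eq_on Ax).
  by apply: pd_eq_on => // y Ay; apply: pd_eq_on => // z Az; rewrite uv.
apply: eq_bigr => k _; apply: congrM; first exact: induced_christoffel_eq_on.
by rewrite (dF_eq_on Ax).
Qed.

Variables (V V' : 'I_n -> 'rV[R]_m -> R).
Hypothesis VV' : forall a z, A z -> V a z = V' a z.

Lemma nabla1_eq_on j a x : A x -> nabla1 G u t V j a x = nabla1 G v t V' j a x.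
Proof.
move=> Ax; apply: congrD; first exact: pd_eq_on (VV' a) Ax.
apply: eq_bigr => b _; apply: eq_bigr => c _; apply: congrM; last exact: VV'.
by rewrite (uv Ax) (dF_eq_on Ax).
Qed.

Lemma nabla2_eq_on i j a x : A x ->
  nabla2 G u t V i j a x = nabla2 G v t V' i j a x.
Proof.
move=> Ax; apply: congrBD.
- exact: pd_eq_on (nabla1_eq_on j a) Ax.
- apply: eq_bigr => k _; apply: congrM; last exact: nabla1_eq_on.
  exact: induced_christoffel_eq_on.
- apply: eq_bigr => b _; apply: eq_bigr => c _; apply: congrM.
    by rewrite (uv Ax) (dF_eq_on Ax).
  exact: nabla1_eq_on.
Qed.
End Locality.

(** * The algebraic identity behind the curvature term *)

Section Algebra.
Context {R : comNzRingType} {m n : nat}.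

Definition contract (G : 'I_n -> 'I_n -> R) (u v : 'I_n -> R) : R :=
  \sum_b \sum_c G b c * u b * v c.

Lemma contractC (G : 'I_n -> 'I_n -> R) (u v : 'I_n -> R) :
  (forall b c, G b c = G c b) -> contract G u v = contract G v u.
Proof.
move=> symG; rewrite /contract exchange_big; apply: eq_bigr => b _.
by apply: eq_bigr => c _; rewrite symG mulrAC.
Qed.

Lemma contractDr G u v w :
  contract G u (fun c => v c + w c) = contract G u v + contract G u w.
Proof.
rewrite /contract -big_split; apply: eq_bigr => b _; rewrite -big_split.
by apply: eq_bigr => c _; rewrite mulrDr.
Qed.

Lemma contractBr G u v w :
  contract G u (fun c => v c - w c) = contract G u v - contract G u w.
Proof.
rewrite /contract -sumrB; apply: eq_bigr => b _; rewrite -sumrB.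
by apply: eq_bigr => c _; rewrite mulrBr.
Qed.

Lemma contract_sumr G u (k : 'I_m -> R) (v : 'I_m -> 'I_n -> R) :
  contract G u (fun c => \sum_i k i * v i c) = \sum_i k i * contract G u (v i).
Proof.
rewrite /contract; under [RHS]eq_bigr do rewrite mulr_sumr.
rewrite [RHS]exchange_big; apply: eq_bigr => b _.
under [RHS]eq_bigr do rewrite mulr_sumr.
rewrite [RHS]exchange_big; apply: eq_bigr => c _.
by rewrite mulr_sumr; apply: eq_bigr => i _; rewrite mulrCA mulrA.
Qed.

(** The comparison of both sides of the evolution equation at one point, as an
    identity between numbers.  G and dG stand for the Christoffel symbols of N
    and their derivatives, P, Q and H for f_i, f_j and df/dt, S for the
    derivatives f_ij; Pt, Qt and Ft k are the derivatives of f_i, f_j and f_k in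
    t, K and C are Gamma^k_ij of M and its derivative in t, and X is
    d_i d_j H^a. *)
Lemma curvature_identity (G : 'I_n -> 'I_n -> 'I_n -> R)
    (dG : 'I_n -> 'I_n -> 'I_n -> R) (a : 'I_n) (P Q H S Pt Qt : 'I_n -> R)
    (X : R) (C K Ft : 'I_m -> R) (F : 'I_m -> 'I_n -> R) :
  (forall a b c, G a b c = G a c b) -> (forall d b c, dG d b c = dG d c b) ->
  X - (\sum_k (C k * F k a + K k * Ft k))
    + \sum_b \sum_c (((\sum_d H d * dG d b c) * P b + G a b c * Pt b) * Q c
                     + G a b c * P b * Qt c)
    + \sum_b \sum_c G a b c * H b *
        (S c - (\sum_k K k * F k c) + contract (G c) P Q)
  = X + \sum_b \sum_c (((\sum_d P d * dG d b c) * Q b + G a b c * S b) * H c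
                     + G a b c * Q b * Pt c)
    - (\sum_k K k * (Ft k + contract (G a) (F k) H))
    + \sum_b \sum_c G a b c * P b * (Qt c + contract (G c) Q H)
    - (\sum_k C k * F k a)
    + \sum_d \sum_c \sum_e
       (dG c e d - dG e c d + \sum_b G a c b * G b e d - \sum_b G a e b * G b c d)
        * Q d * H c * P e.
Proof.
move=> symG symdG.
have expand (w u v ut vt : 'I_n -> R) :
    \sum_b \sum_c (((\sum_d w d * dG d b c) * u b + G a b c * ut b) * v c
                     + G a b c * u b * vt c) =
    \sum_d w d * contract (dG d) u v + contract (G a) ut v + contract (G a) u vt.
  rewrite /contract.
  have -> : \sum_d w d * (\sum_b \sum_c dG d b c * u b * v c) =
      \sum_b \sum_c (\sum_d w d * dG d b c) * u b * v c.
    under eq_bigr do rewrite mulr_sumr.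
    rewrite exchange_big; apply: eq_bigr => b _.
    under eq_bigr do rewrite mulr_sumr.
    rewrite exchange_big; apply: eq_bigr => c _.
    by rewrite !mulr_suml; apply: eq_bigr => d _; rewrite !mulrA.
  rewrite -!big_split; apply: eq_bigr => b _; rewrite -!big_split.
  by apply: eq_bigr => c _; rewrite mulrDl.
rewrite !expand -!/(contract _ _ _) contractDr contractBr contract_sumr contractDr.
have curv : \sum_d \sum_c \sum_e
       (dG c e d - dG e c d + \sum_b G a c b * G b e d - \sum_b G a e b * G b c d)
        * Q d * H c * P e =
    \sum_c H c * contract (dG c) P Q - \sum_e P e * contract (dG e) Q H
    + contract (G a) H (fun c => contract (G c) P Q)
    - contract (G a) P (fun c => contract (G c) Q H).
  (* all four parts of the curvature are sums of this shape *)
  pose T (Z : 'I_n -> 'I_n -> 'I_n -> R) :=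
    \sum_d \sum_c \sum_e Z d c e * Q d * H c * P e.
  have -> : \sum_c H c * contract (dG c) P Q = T (fun d c e => dG c e d).
    rewrite /T exchange_big; apply: eq_bigr => c _; rewrite /contract exchange_big.
    rewrite mulr_sumr; apply: eq_bigr => d _; rewrite mulr_sumr.
    by apply: eq_bigr => e _ /=; ring.
  have -> : \sum_e P e * contract (dG e) Q H = T (fun d c e => dG e c d).
    rewrite /T; under [RHS]eq_bigr do rewrite exchange_big.
    rewrite [RHS]exchange_big; apply: eq_bigr => e _.
    rewrite mulr_sumr; apply: eq_bigr => d _; rewrite mulr_sumr.
    by apply: eq_bigr => c _ /=; rewrite symdG; ring.
  have -> : contract (G a) H (fun c => contract (G c) P Q) =
      T (fun d c e => \sum_b G a c b * G b e d).
    rewrite /T exchange_big; apply: eq_bigr => c _ /=.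
    under [RHS]eq_bigr do under eq_bigr do rewrite !mulr_suml.
    under [RHS]eq_bigr do rewrite exchange_big.
    rewrite [RHS]exchange_big; apply: eq_bigr => b _.
    rewrite /contract exchange_big mulr_sumr; apply: eq_bigr => d _.
    by rewrite mulr_sumr; apply: eq_bigr => e _ /=; ring.
  have -> : contract (G a) P (fun c => contract (G c) Q H) =
      T (fun d c e => \sum_b G a e b * G b c d).
    rewrite /T; under [RHS]eq_bigr do rewrite exchange_big.
    rewrite [RHS]exchange_big; apply: eq_bigr => e _ /=.
    under [RHS]eq_bigr do under eq_bigr do rewrite !mulr_suml.
    under [RHS]eq_bigr do rewrite exchange_big.
    rewrite [RHS]exchange_big; apply: eq_bigr => b _.
    rewrite /contract mulr_sumr; apply: eq_bigr => d _.
    by rewrite mulr_sumr; apply: eq_bigr => c _ /=; rewrite (symG b); ring.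
  rewrite /T -!sumrB -!big_split -!sumrB; apply: eq_bigr => d _.
  rewrite -!sumrB -!big_split -!sumrB; apply: eq_bigr => c _.
  rewrite -!sumrB -!big_split -!sumrB; apply: eq_bigr => e _.
  by rewrite /=; ring.
rewrite curv (contractC H S) // (contractC Q Pt) //.
under [X in _ = _ - X + _ - _ + _]eq_bigr do rewrite mulrDr.
have -> : \sum_k K k * contract (G a) H (F k) = \sum_k K k * contract (G a) (F k) H.
  by apply: eq_bigr => k _; rewrite contractC.
by rewrite !big_split /=; ring.
Qed.
End Algebra.

(** * Evolution of the second fundamental form in coordinates *)

(** Space and time are put together: f is a map of (x, t), smooth on an open
    set W, so that space and time derivatives are directional derivatives of
    functions of one variable w = (x, t). *)
Section Evolution.
Context {R : realType} {m n : nat}.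
Variables (O : set 'rV[R]_n) (G : 'rV[R]_n -> 'M[R]_n).
Variables (W : set ('rV[R]_m * R)) (f : 'rV[R]_m * R -> 'rV[R]_n).
Hypotheses (oO : open O) (oW : open W) (fWO : forall w, W w -> O (f w)).
Hypotheses (sf : smooth_on W f) (sG : smooth_on O G).
Hypothesis uG : forall y, O y -> G y \in unitmx.
Hypothesis symG : forall y, O y -> (G y)^T = G y.
Let u (t : R) (z : 'rV[R]_m) : 'rV[R]_n := f (z, t).
Hypothesis uh : forall w, W w -> induced_metric G u w.2 w.1 \in unitmx.

Local Notation Gam a b c := (christoffel G a b c).

Definition dirx (i : 'I_m) : 'rV[R]_m * R := (delta_mx 0 i, 0).
Definition dirt : 'rV[R]_m * R := (0, 1).
Definition space_der (i : 'I_m) (a : 'I_n) := 'D_(dirx i) (fun w => f w 0 a).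
Definition velocity (a : 'I_n) := 'D_dirt (fun w => f w 0 a).
Definition flow_christoffel (k i j : 'I_m) (w : 'rV[R]_m * R) : R :=
  induced_christoffel G u k i j w.2 w.1.
Definition flow_second_form (a : 'I_n) (i j : 'I_m) (w : 'rV[R]_m * R) : R :=
  'D_(dirx i) (space_der j a) w - \sum_k flow_christoffel k i j w * space_der k a w
  + \sum_b \sum_c Gam a b c (f w) * space_der i b w * space_der j c w.
Definition nabla_velocity (j : 'I_m) (a : 'I_n) (w : 'rV[R]_m * R) : R :=
  'D_(dirx j) (velocity a) w + \sum_b \sum_c Gam a b c (f w) * space_der j b w * velocity c w.

Lemma dF_space_der t z i a : dF u t z i a = space_der i a (z, t).
Proof. by rewrite mxE; exact: (pd_slice (fun w => f w 0 a)). Qed.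

Lemma second_formE a i j t z : second_form G u a i j t z = flow_second_form a i j (z, t).
Proof.
have E1 : pd j (fun z => u t z 0 a) = fun z => space_der j a (z, t).
  by apply/funext => y; exact: (pd_slice (fun w => f w 0 a)).
rewrite /second_form E1 (pd_slice (space_der j a)) /flow_second_form.
under eq_bigr do rewrite dF_space_der.
by under [X in _ + X]eq_bigr do under eq_bigr do rewrite !dF_space_der.
Qed.

Lemma nabla1_velocity j a t z :
  nabla1 G u t (fun b y => velocity b (y, t)) j a z = nabla_velocity j a (z, t).
Proof.
rewrite /nabla1 (pd_slice (velocity a)) /nabla_velocity.
by under eq_bigr do under eq_bigr do rewrite !dF_space_der.
Qed.

Lemma nabla2_velocity i j a t z :
  nabla2 G u t (fun b y => velocity b (y, t)) i j a z =
  'D_(dirx i) (nabla_velocity j a) (z, t)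
  - \sum_k flow_christoffel k i j (z, t) * nabla_velocity k a (z, t)
  + \sum_b \sum_c Gam a b c (f (z, t)) * space_der i b (z, t) * nabla_velocity j c (z, t).
Proof.
have E1 : nabla1 G u t (fun b y => velocity b (y, t)) j a = fun y => nabla_velocity j a (y, t).
  by apply/funext => y; exact: nabla1_velocity.
rewrite /nabla2 E1 (pd_slice (nabla_velocity j a)).
under eq_bigr do rewrite nabla1_velocity.
by under [X in _ + X]eq_bigr do under eq_bigr do rewrite dF_space_der nabla1_velocity.
Qed.

Lemma smooth_on_component a : smooth_on W (fun w => f w 0 a).
Proof. exact: smooth_on_coord. Qed.

Lemma smooth_on_space_der i a : smooth_on W (space_der i a).
Proof. exact: smooth_on_derive (smooth_on_component a). Qed.

Lemma smooth_on_velocity a : smooth_on W (velocity a).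
Proof. exact: smooth_on_derive (smooth_on_component a). Qed.

Lemma smooth_on_induced_metric i j :
  smooth_on W (fun w => induced_metric G u w.2 w.1 i j).
Proof.
have -> : (fun w => induced_metric G u w.2 w.1 i j) =
    fun w => \sum_a \sum_b G (f w) a b * space_der i a w * space_der j b w.
  apply/funext => -[z t]; rewrite mxE.
  by under eq_bigr do under eq_bigr do rewrite !dF_space_der.
apply: smooth_on_sum => // a; apply: smooth_on_sum => // b.
apply: (smooth_onM oW); last exact: smooth_on_space_der.
apply: (smooth_onM oW); last exact: smooth_on_space_der.
exact: smooth_on_comp oW oO fWO (smooth_on_coord a b oO sG) sf.
Qed.

(** This is what makes the product rule applicable to Gamma^k_ij f_k: the
    induced metric is smooth in (x, t) jointly, and invertible on W. *)
Lemma smooth_on_flow_christoffel k i j : smooth_on W (flow_christoffel k i j).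
Proof.
have sd v a b :
    smooth_on W (fun w => pd v (fun y => induced_metric G u w.2 y a b) w.1).
  pose h w := induced_metric G u w.2 w.1 a b.
  have -> : (fun w => pd v (fun y => induced_metric G u w.2 y a b) w.1) =
      'D_(dirx v) h by apply/funext => -[z t]; exact: (pd_slice h).
  exact: smooth_on_derive (smooth_on_induced_metric a b).
rewrite /flow_christoffel /induced_christoffel /christoffel.
apply: (smooth_onM oW); first exact: smooth_on_cst.
apply: smooth_on_sum => // l; apply: (smooth_onM oW).
  by apply: smooth_on_invmx => // a b; exact: smooth_on_induced_metric.
exact: smooth_onB oW (smooth_onD oW (sd i j l) (sd j i l)) (sd l i j).
Qed.

Lemma smooth_on_flow_second_form a i j : smooth_on W (flow_second_form a i j).
Proof.
apply: (smooth_onD oW).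
  apply: (smooth_onB oW); first exact: smooth_on_derive (smooth_on_space_der j a).
  apply: smooth_on_sum => // k.
  exact: smooth_onM oW (smooth_on_flow_christoffel k i j) (smooth_on_space_der k a).
apply: smooth_on_sum => // b; apply: smooth_on_sum => // c.
apply: (smooth_onM oW) (smooth_on_space_der j c).
apply: (smooth_onM oW) (smooth_on_space_der i b).
exact: smooth_on_comp oW oO fWO (smooth_on_christoffel a b c oO sG uG) sf.
Qed.

Lemma is_derive_contraction (a : 'I_n) (P Q : 'I_n -> 'rV[R]_m * R -> R) w v :
  (forall b, smooth_on W (P b)) -> (forall c, smooth_on W (Q c)) -> W w ->
  is_derive w v (fun w => \sum_b \sum_c Gam a b c (f w) * P b w * Q c w)
   (\sum_b \sum_c
     (((\sum_d 'D_v (fun w => f w 0 d) w * pd d (Gam a b c) (f w)) * P b w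
       + Gam a b c (f w) * 'D_v (P b) w) * Q c w
      + Gam a b c (f w) * P b w * 'D_v (Q c) w)).
Proof.
move=> sP sQ Ww; apply: is_derive_bigsum => b; apply: is_derive_bigsum => c.
apply: is_derive_mul; last exact: smooth_on_is_derive (sQ c) Ww.
apply: is_derive_mul; last exact: smooth_on_is_derive (sP b) Ww.
exact: is_derive_smooth_comp v oO (fWO Ww)
  (smooth_on_christoffel a b c oO sG uG) sf Ww.
Qed.

(** d/dt f_i = d_i df/dt, the form in which the symmetry of second derivatives
    is used. *)
Lemma derive_space_der i a w : W w -> 'D_dirt (space_der i a) w =
  'D_(dirx i) (velocity a) w.
Proof. exact: smooth_on_derive_swap (smooth_on_component a). Qed.

(** The velocity df/dt takes the place of H; the flow equation identifies the
    two. *)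
Lemma evolution a i j w : W w ->
  'D_dirt (flow_second_form a i j) w
    + \sum_b \sum_c Gam a b c (f w) * velocity b w * flow_second_form c i j w =
  'D_(dirx i) (nabla_velocity j a) w - \sum_k flow_christoffel k i j w * nabla_velocity k a w
    + \sum_b \sum_c Gam a b c (f w) * space_der i b w * nabla_velocity j c w
    - \sum_k 'D_dirt (flow_christoffel k i j) w * space_der k a w
    + \sum_d \sum_c \sum_e riemann_up G a d c e (f w)
        * space_der j d w * velocity c w * space_der i e w.
Proof.
move=> Ww.
(* d/dt d_i d_j f = d_i d_j df/dt, in two exchanges *)
have swap2 : 'D_dirt ('D_(dirx i) (space_der j a)) w =
    'D_(dirx i) ('D_(dirx j) (velocity a)) w.
  apply: (etrans (smooth_on_derive_swap _ _ oW (smooth_on_space_der j a) Ww)).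
  apply: (derive_eq_on _ oW _ Ww) => w'; rewrite inE => Ww'.
  exact: derive_space_der.
have Dform : is_derive w dirt (flow_second_form a i j)
   ('D_(dirx i) ('D_(dirx j) (velocity a)) w
    - \sum_k ('D_dirt (flow_christoffel k i j) w * space_der k a w
              + flow_christoffel k i j w * 'D_(dirx k) (velocity a) w)
    + \sum_b \sum_c
     (((\sum_d velocity d w * pd d (Gam a b c) (f w)) * space_der i b w
       + Gam a b c (f w) * 'D_(dirx i) (velocity b) w) * space_der j c w
      + Gam a b c (f w) * space_der i b w * 'D_(dirx j) (velocity c) w)).
  apply: is_derive_add.
    apply: is_derive_sub.
      apply: (is_derive_eq _ swap2).
      exact: smooth_on_is_derive (smooth_on_derive _ (smooth_on_space_der j a)) Ww.
    apply: is_derive_bigsum => k; apply: is_derive_mul.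
      exact: smooth_on_is_derive (smooth_on_flow_christoffel k i j) Ww.
    apply: (is_derive_eq _ (derive_space_der k a Ww)).
    exact: smooth_on_is_derive (smooth_on_space_der k a) Ww.
  apply: is_derive_eq.
    exact: is_derive_contraction (smooth_on_space_der i) (smooth_on_space_der j) Ww.
  apply: eq_bigr => b _; apply: eq_bigr => c _.
  by rewrite (derive_space_der i b Ww) (derive_space_der j c Ww).
have Dnabla : is_derive w (dirx i) (nabla_velocity j a)
   ('D_(dirx i) ('D_(dirx j) (velocity a)) w + \sum_b \sum_c
     (((\sum_d space_der i d w * pd d (Gam a b c) (f w)) * space_der j b w
       + Gam a b c (f w) * 'D_(dirx i) (space_der j b) w) * velocity c w
      + Gam a b c (f w) * space_der j b w * 'D_(dirx i) (velocity c) w)).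
  apply: is_derive_add.
    exact: smooth_on_is_derive (smooth_on_derive _ (smooth_on_velocity a)) Ww.
  exact: is_derive_contraction (smooth_on_space_der j) smooth_on_velocity Ww.
rewrite (@derive_val _ _ _ _ _ _ _ Dform) (@derive_val _ _ _ _ _ _ _ Dnabla).
pose curv d c e := pd c (Gam a e d) (f w) - pd e (Gam a c d) (f w)
  + \sum_b Gam a c b (f w) * Gam b e d (f w)
  - \sum_b Gam a e b (f w) * Gam b c d (f w).
have Riem : \sum_d \sum_c \sum_e
      curv d c e * space_der j d w * velocity c w * space_der i e w =
    \sum_d \sum_c \sum_e riemann_up G a d c e (f w)
        * space_der j d w * velocity c w * space_der i e w.
  apply: eq_bigr => d _; apply: eq_bigr => c _; apply: eq_bigr => e _.
  apply: (congr1 (fun r => r * space_der j d w * velocity c w * space_der i e w)).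
  by apply: esym; apply: riemann_upE; apply: uG; exact: fWO.
apply: (etrans (@curvature_identity R m n (fun a b c => Gam a b c (f w))
  (fun d b c => pd d (Gam a b c) (f w)) a
  (space_der i ^~ w) (space_der j ^~ w) (velocity ^~ w)
  (fun b => 'D_(dirx i) (space_der j b) w) (fun b => 'D_(dirx i) (velocity b) w)
  (fun b => 'D_(dirx j) (velocity b) w) _
  (fun k => 'D_dirt (flow_christoffel k i j) w) (fun k => flow_christoffel k i j w)
  (fun k => 'D_(dirx k) (velocity a) w) (fun k b => space_der k b w) _ _)).
- by move=> a' b c; exact: christoffelC (fWO Ww) symG.
- move=> d b c; apply: (derive_eq_on _ oO _ (fWO Ww)) => y; rewrite inE => Oy.
  exact: christoffelC Oy symG.
- exact: congr1 Riem.
Qed.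
End Evolution.

(** * The evolution equation *)

Unset Implicit Arguments.
Set Strict Implicit.
Set Printing Implicit Defensive.

Theorem lemma3p7 (R : realType) (M N : topologicalType) (m n : nat)
    (SM : smooth_structure R M m) (SN : smooth_structure R N n)
    (O : orientation SM) (g : riemannian_metric SN)
    (T : \bar R) (F : M -> R -> N)
    (M_compact : compact [set: M]) (T_gt0 : (0 < T)%E)
    (F_mcf : mean_curvature_flow SM g T F)
    (phi : chart R M m) (psi : chart R N n) (p : M) (t : R)
    (phi_atlas : atlas SM phi) (psi_atlas : atlas SN psi)
    (phi_p : chart_dom phi p) (t_dom : time_dom T t)
    (psi_Fpt : chart_dom psi (F p t))
    (a : 'I_n) (i j : 'I_m) :
  let G := metric_mx g psi in
  let u := local_rep phi psi F in
  let x := chart_fun phi p in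
  let H := mean_curvature G u in
  nabla_dt_second_form T G u a i j t x =
    nabla2 G u t (fun b => H b t) i j a x
    - \sum_k ddt_christoffel T G u k i j t x * dF u t x k a
    + \sum_d \sum_c \sum_e
        riemann_up G a d c e (u t x)
        * dF u t x j d * H c t x * dF u t x i e.
Proof.
move=> G u x H.
have [W0 [f [oW0 W0xt sf0 fE]]] :=
  mcf_smooth F_mcf phi_atlas psi_atlas phi_p t_dom psi_Fpt.
pose v s z := f (z, s).
have oO : open (chart_cod psi) by exact: chart_cod_open.
have sG : smooth_on (chart_cod psi) G by exact: metric_smooth.
have Gpos y : chart_cod psi y -> forall w : 'rV[R]_n, w != 0 ->
    0 < (w *m G y *m w^T) 0 0 by move=> Oy w; exact: metric_pos.
have uG y : chart_cod psi y -> G y \in unitmx.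
  by move=> Oy; apply: posdef_unitmx; exact: Gpos.
have symG y : chart_cod psi y -> (G y)^T = G y by move=> Oy; exact: Defs.metric_sym.
(* The extension f is restricted to the open set W of points (z, s) where z is
   in the chart of M, f (z, s) is in the chart of N and the metric induced by f
   is invertible; the latter holds near (x, t) since F_t is an immersion. *)
pose W1 := W0 `&` fst @^-1` chart_cod phi.
have oW1 : open W1.
  apply: (open_setI_preimage oW0) => [|w _]; first exact: chart_cod_open.
  exact: cvg_fst.
pose W2 := W1 `&` f @^-1` chart_cod psi.
have oW2 : open W2.
  apply: (open_setI_preimage oW1 oO) => w [W0w _].
  exact: (smooth_on_continuous sf0 W0w).
have sf2 : smooth_on W2 f by apply: smooth_on_sub sf0 => w [[]].
have fW2 w : W2 w -> chart_cod psi (f w) by case.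
pose W := W2 `&` (fun w => \det (induced_metric G v w.2 w.1)) @^-1` [set r | r != 0].
have oW : open W.
  apply: (open_setI_preimage oW2) => [|w W2w]; first exact: open_neq.
  apply: smooth_on_continuous W2w; apply: smooth_on_det => // k l.
  exact: smooth_on_induced_metric oO oW2 fW2 sf2 sG k l.
have sf : smooth_on W f by apply: smooth_on_sub sf2 => w [].
have fW w : W w -> chart_cod psi (f w) by move=> [/fW2].
have uh w : W w -> induced_metric G v w.2 w.1 \in unitmx.
  by move=> [_]; rewrite unitmxE unitfE.
(* On W, at times of [0, T), f represents F, and the flow equation says that
   the mean curvature is the time derivative of f. *)
have uv0 z s : W1 (z, s) -> time_dom T s ->
    chart_dom psi (F (chart_inv phi z) s) /\ u s z = v s z.
  move=> [W0zs phiz] Ts; have [dzs E] := fE z s W0zs phiz Ts.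
  by split; [exact: dzs|exact: esym E].
have uv s : time_dom T s -> forall z, W (z, s) -> u s z = v s z.
  by move=> Ts z [[W1zs _] _]; have [] := uv0 z s W1zs Ts.
have phix : chart_cod phi x by exact: chart_funP.
have W1xt : W1 (x, t) by [].
have uvxt : u t x = v t x by have [] := uv0 x t W1xt t_dom.
have W2xt : W2 (x, t).
  split=> //; rewrite /preimage /= -[f _]/(v t x) -uvxt /u /local_rep chart_funK//.
  exact: chart_funP.
have Wxt : W (x, t).
  split=> //; rewrite /preimage /= -unitfE -unitmxE.
  have A1 : open [set z | W1 (z, t)] by exact: open_slicel.
  rewrite -(@induced_metric_eq_on R m n _ A1 G u v t) //; last first.
    by move=> z W1z; have [] := uv0 z t W1z t_dom.
  apply: induced_metric_unitmx; first exact: (mcf_immersion F_mcf).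
  by apply: Gpos; rewrite uvxt; exact: fW2.
have slice s : open [set z | W (z, s)] by exact: open_slicel.
have HE b s z : time_dom T s -> W (z, s) -> H b s z = velocity f b (z, s).
  move=> Ts Wzs; have [[[W0zs phiz0] _] _] := Wzs.
  have phiz : chart_cod phi z := phiz0.
  have [dzs _] := uv0 z s (conj W0zs phiz) Ts.
  have := mcf_flow F_mcf phi_atlas psi_atlas (chart_invP phiz) Ts dzs b.
  rewrite chart_invK// => flow; apply: (etrans (esym flow)).
  apply: (ddt_derive Ts (f := fun w => f w 0 b) (x := z)).
    by apply: smooth_on_is_derive Wzs; exact: smooth_on_coord.
  apply: filterS (near_slicer oW Wzs) => r Wzr Tr.
  exact: (congr1 (fun y : 'rV[R]_n => y 0 b) (uv r Tr z Wzr)).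
(* The values of all terms at (x, t), with u replaced by f. *)
have dFE k b : dF u t x k b = space_der f k b (x, t).
  by rewrite (dF_eq_on (slice t) (uv t t_dom) Wxt) dF_space_der.
have sffE c s : time_dom T s -> W (x, s) ->
    second_form G u c i j s x = flow_second_form G f c i j (x, s).
  move=> Ts Wxs; rewrite (second_form_eq_on (slice s) _ (uv s Ts) _ _ _ Wxs).
  exact: second_formE.
have nWxt := near_slicer oW Wxt.
have dsff : ddt T (fun s => second_form G u a i j s x) t =
    'D_dirt (flow_second_form G f a i j) (x, t).
  apply: (ddt_derive t_dom (f := flow_second_form G f a i j) (x := x)).
    apply: smooth_on_is_derive Wxt.
    exact: smooth_on_flow_second_form oO oW fW sf sG uG uh a i j.
  by apply: filterS nWxt => s Wxs Ts; exact: sffE.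
have dchr k : ddt_christoffel T G u k i j t x =
    'D_dirt (flow_christoffel G f k i j) (x, t).
  apply: (ddt_derive t_dom (f := flow_christoffel G f k i j) (x := x)).
    apply: smooth_on_is_derive Wxt.
    exact: smooth_on_flow_christoffel oO oW fW sf sG uh k i j.
  apply: filterS nWxt => s Wxs Ts.
  exact: (induced_christoffel_eq_on (slice s) _ (uv s Ts) _ _ _ Wxs).
have nabla2E : nabla2 G u t (fun b => H b t) i j a x =
    nabla2 G v t (fun b y => velocity f b (y, t)) i j a x.
  apply: (nabla2_eq_on (slice t) _ (uv t t_dom)) Wxt => b z Wzt.
  exact: HE.
have evol := evolution oO oW fW sf sG uG symG uh a i j Wxt.
rewrite nabla2E nabla2_velocity.
apply: (etrans _ (etrans evol _)).
  apply: (congrD dsff); apply: eq_bigr => b _; apply: eq_bigr => c _.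
  apply: congrM; last exact: sffE.
  by apply: congrM; [rewrite uvxt|exact: HE].
apply: congrD.
  apply: congrD; first by [].
  apply: (congr1 -%R); apply: eq_bigr => k _.
  by apply: congrM; apply: esym; [exact: dchr|exact: dFE].
apply: eq_bigr => d _; apply: eq_bigr => c _; apply: eq_bigr => e _.
apply: congrM; last exact: esym (dFE _ _).
apply: congrM; last exact: esym (HE _ _ _ t_dom Wxt).
by apply: congrM; [rewrite uvxt|exact: esym (dFE _ _)].
Qed.
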